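(* For Bara\'nski carpets, the conditions $\textbf{u.f.H}$, $\textbf{u.f.B}$, $\textbf{u.f.A}$, $\textbf{u.f.L}$ satisfy $$\textbf{u.f.L}\Longrightarrow\textbf{u.f.A}\Longrightarrow\textbf{u.f.B}\Longrightarrow\textbf{u.f.H},$$ and these implications are strict; that is, each implication holds for every Bara\'nski carpet, and for each of the three implications there is a Bara\'nski carpet for which the converse implication fails.
   Context: **Bara\'nski carpets.** Let $r,s,d\ge 2$ be integers with $d\le rs$. For $1\le i\le r$, $1\le j\le s$ let $0<a_i,b_j<1$ with $\sum_{i=1}^r a_i=1$, $\sum_{j=1}^s b_j=1$. Let $\mathcal{J}=\{(i_1,j_1),\dots,(i_d,j_d)\}\subseteq\{1,\dots,r\}\times\{1,\dots,s\}$ be a set of $d$ pairs. For $l=1,\dots,d$ let $\psi_l(x,y)=\big(a_{i_l}x+\sum_{i<i_l}a_i,\; b_{j_l}y+\sum_{j<j_l}b_j\big)$. The Bara\'nski carpet $K$ is the attractor of $\{\psi_1,\dots,\psi_d\}$, i.e. the unique non-empty compact set with $K=\bigcup_{l=1}^d\psi_l(K)$. Standing assumption, made for every Bara\'nski carpet: there is $l$ with $a_{i_l}\ne b_{j_l}$, and $K$ is not contained in any vertical or horizontal line. $K$ is of horizontal type if $a_{i_l}\ge b_{j_l}$ for all $l$; of vertical type if $a_{i_l}\le b_{j_l}$ for all $l$; of mixed type otherwise. **Notation.** $\mathcal{S}=\{\bm q\in\mathbb{R}^d: q_l\ge 0,\ \sum_l q_l=1\}$. $I_i=\{l: i_l=i\}$,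 $J_j=\{l: j_l=j\}$, $R_i(\bm q)=\sum_{l\in I_i}q_l$, $S_j(\bm q)=\sum_{l\in J_j}q_l$, $\mathcal{J}_1=\{i: I_i\ne\emptyset\}$, $\mathcal{J}_2=\{j: J_j\neq\emptyset\}$. With $0\log 0=0$: $RR(\bm q)=\sum_i R_i(\bm q)\log R_i(\bm q)$, $SS(\bm q)=\sum_j S_j(\bm q)\log S_j(\bm q)$, $QQ(\bm q)=\sum_l q_l\log q_l$, $RA(\bm q)=\sum_l q_l\log a_{i_l}$, $SB(\bm q)=\sum_l q_l\log b_{j_l}$. $\mathcal{S}_1=\{\bm q\in\mathcal{S}: RA(\bm q)\ge SB(\bm q)\}$, $\mathcal{S}_2=\{\bm q\in\mathcal{S}: RA(\bm q)\le SB(\bm q)\}$. Define $g(\bm q)=\frac{RR(\bm q)}{RA(\bm q)}+\frac{QQ(\bm q)-RR(\bm q)}{SB(\bm q)}$ for $\bm q\in\mathcal{S}_1$, and $g(\bm q)=\frac{SS(\bm q)}{SB(\bm q)}+\frac{QQ(\bm q)-SS(\bm q)}{RA(\bm q)}$ for $\bm q\in\mathcal{S}_2\setminus\mathcal{S}_1$. (It is known, by Bara\'nski, that $\dim_{\mathrm H}K=\max_{\mathcal{S}}g$.) $t_1,t_2$ are the unique reals with $\sum_{i\in\mathcal{J}_1}a_i^{t_1}=1$, $\sum_{j\in\mathcal{J}_2}b_j^{t_2}=1$; $D_1,D_2$ the unique reals with $\sum_{l}a_{i_l}^{t_1}b_{j_l}^{D_1-t_1}=1$, $\sum_{l}b_{j_l}^{t_2}a_{i_l}^{D_2-t_2}=1$;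 for each $l$, $S_{1,l},S_{2,l}$ are the unique solutions of $\sum_{m\in I_{i_l}}b_{j_m}^{S_{1,l}}=1$, $\sum_{m\in J_{j_l}}a_{i_m}^{S_{2,l}}=1$. Define $E_1,E_2,F_1,F_2$ by: - horizontal type: $E_1=t_1+\max_l S_{1,l}$, $E_2=-1$, $F_1=t_1+\min_l S_{1,l}$, $F_2=3$; - vertical type: $E_1=-1$, $E_2=t_2+\max_l S_{2,l}$, $F_1=3$, $F_2=t_2+\min_l S_{2,l}$; - mixed type: $E_1=t_1+\max_l S_{1,l}$, $E_2=t_2+\max_l S_{2,l}$, $F_1=t_1+\min_l S_{1,l}$, $F_2=t_2+\min_l S_{2,l}$. **Fibre conditions.** $K$ has uniform vertical fibres if there is $t\ge0$ with $\sum_{l\in I_i}b_{j_l}^t=1$ for all $i\in\mathcal{J}_1$; uniform horizontal fibres if there is $t\ge 0$ with $\sum_{l\in J_j}a_{i_l}^t=1$ for all $j\in\mathcal{J}_2$. $\textbf{u.f.H}$: both of the following hold: if some $\bm q\in\mathcal{S}_1$ has $g(\bm q)=\dim_{\mathrm H}K$, then $K$ has uniform vertical fibres; if some $\bm q\in\mathcal{S}_2$ has $g(\bm q)=\dim_{\mathrm H}K$, then $K$ has uniform horizontal fibres. $\textbf{u.f.B}$: $K$ has uniform vertical fibres if $D_1>D_2$; uniform horizontal fibres if $D_1<D_2$; uniform vertical or uniform horizontal fibres if $D_1=D_2$. $\textbf{u.f.A}$: $K$ has uniform vertical fibres if $E_1>E_2$; uniform horizontal fibres if $E_1<E_2$;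 uniform vertical or uniform horizontal fibres if $E_1=E_2$. $\textbf{u.f.L}$: $K$ has uniform vertical fibres if $K$ is of horizontal type; uniform horizontal fibres if $K$ is of vertical type; both uniform vertical and uniform horizontal fibres, and $F_1=F_2$, if $K$ is of mixed type. *)

(* Defs.v *)
From HB Require Import structures.
From mathcomp Require Import all_boot all_order all_algebra.
From mathcomp Require Import all_classical all_reals all_analysis.
Set Implicit Arguments.
Unset Strict Implicit.
Unset Printing Implicit Defensive.
Import Order.TTheory GRing.Theory Num.Theory numFieldNormedType.Exports.
Local Open Scope classical_set_scope.
Local Open Scope ring_scope.

(** * Hausdorff dimension in the Euclidean plane *)

Section Hausdorff.
Variable R : realType.
Implicit Types (A U : set (R * R)) (s delta : R).

(* The norm that the library puts on [R * R] is the sup norm. *)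
Definition dist2 (x y : R * R) : R :=
  Num.sqrt ((x.1 - y.1) ^+ 2 + (x.2 - y.2) ^+ 2).

Definition diam U : \bar R :=
  ereal_sup [set (dist2 x y)%:E | x in U & y in U].

(* |U|^s, with |U|^0 = 1 for nonempty U.  The empty set has to be treated
   apart, since its [diam] is -oo. *)
Definition diam_pow s U : \bar R :=
  if `[< U = set0 >] then 0%E else poweR (diam U) s.

Definition is_cover delta A (U : nat -> set (R * R)) : Prop :=
  (forall k, (diam (U k) <= delta%:E)%E) /\ A `<=` \bigcup_k U k.

Definition hausdorff_pre s delta A : \bar R :=
  ereal_inf [set (\sum_(0 <= k <oo) diam_pow s (U k))%E | U in is_cover delta A].

Definition hausdorff_measure s A : \bar R :=
  ereal_sup [set hausdorff_pre s delta A | delta in [set delta | 0 < delta]].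

Definition hausdorff_dim A : \bar R :=
  ereal_inf [set s%:E | s in [set s | 0 <= s /\ hausdorff_measure s A = 0%E]].

End Hausdorff.

(** * Baranski carpets *)

(* Indices start at 0.  The l-th map of the system is placed in column
   [col l] and row [row l]; injectivity of [l |-> (col l, row l)] makes these
   [nmap] pairs distinct. *)
Record baranski_ifs (R : realType) := BaranskiIFS {
  ncol : nat;
  nrow : nat;
  nmap : nat;
  ncol_ge2 : (2 <= ncol)%N;
  nrow_ge2 : (2 <= nrow)%N;
  nmap_ge2 : (2 <= nmap)%N;
  nmap_le : (nmap <= ncol * nrow)%N;
  width : 'I_ncol -> R;
  height : 'I_nrow -> R;
  width_itv : forall i, 0 < width i < 1;
  height_itv : forall j, 0 < height j < 1;
  width_sum : \sum_i width i = 1;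
  height_sum : \sum_j height j = 1;
  pos : 'I_nmap -> 'I_ncol * 'I_nrow;
  pos_inj : injective pos
}.

Section IFS.
Variables (R : realType) (C : baranski_ifs R).

Definition col (l : 'I_(nmap C)) : 'I_(ncol C) := (pos l).1.
Definition row (l : 'I_(nmap C)) : 'I_(nrow C) := (pos l).2.

(* The contraction ratios a_{i_l} and b_{j_l}. *)
Definition aa (l : 'I_(nmap C)) : R := width (col l).
Definition bb (l : 'I_(nmap C)) : R := height (row l).

Definition psi (l : 'I_(nmap C)) (p : R * R) : R * R :=
  (aa l * p.1 + \sum_(i < ncol C | (i < col l)%N) width i,
   bb l * p.2 + \sum_(j < nrow C | (j < row l)%N) height j).

Definition is_attractor (K : set (R * R)) : Prop :=
  [/\ K !=set0, compact K & K = \bigcup_l (psi l @` K)].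

End IFS.

(* By Hutchinson's theorem [attr] is determined by [ifs]. *)
Record carpet (R : realType) := Carpet {
  ifs :> baranski_ifs R;
  attr : set (R * R);
  attrP : is_attractor ifs attr;
  aa_neq_bb : exists l : 'I_(nmap ifs), aa l != bb l;
  attr_not_vertical : ~ exists c : R, attr `<=` [set p | p.1 = c];
  attr_not_horizontal : ~ exists c : R, attr `<=` [set p | p.2 = c]
}.

Section Carpet.
Variables (R : realType) (C : carpet R).
Implicit Types (l : 'I_(nmap C)) (q : 'I_(nmap C) -> R).

(* These are exclusive, because of [aa_neq_bb]. *)
Definition horizontal_type : bool := [forall l : 'I_(nmap C), bb l <= aa l].
Definition vertical_type : bool := [forall l : 'I_(nmap C), aa l <= bb l].
Definition mixed_type : bool := ~~ horizontal_type && ~~ vertical_type.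

Definition colset (i : 'I_(ncol C)) : {set 'I_(nmap C)} :=
  [set l | col l == i]%SET.
Definition rowset (j : 'I_(nrow C)) : {set 'I_(nmap C)} :=
  [set l | row l == j]%SET.

Definition J1 : {set 'I_(ncol C)} := [set i | colset i != finset.set0]%SET.
Definition J2 : {set 'I_(nrow C)} := [set j | rowset j != finset.set0]%SET.

(** ** The function g *)

Definition simplex : set ('I_(nmap C) -> R) :=
  [set q | (forall l, 0 <= q l) /\ \sum_l q l = 1].

Definition Rcol q (i : 'I_(ncol C)) : R := \sum_(l in colset i) q l.
Definition Srow q (j : 'I_(nrow C)) : R := \sum_(l in rowset j) q l.

Definition RR q : R := \sum_i Rcol q i * ln (Rcol q i).
Definition SS q : R := \sum_j Srow q j * ln (Srow q j).
Definition QQ q : R := \sum_l q l * ln (q l).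
Definition RA q : R := \sum_l q l * ln (aa l).
Definition SB q : R := \sum_l q l * ln (bb l).

Definition simplex1 : set ('I_(nmap C) -> R) :=
  simplex `&` [set q | SB q <= RA q].
Definition simplex2 : set ('I_(nmap C) -> R) :=
  simplex `&` [set q | RA q <= SB q].

(* Only meant for q in [simplex]; there the [else] branch is
   [simplex2 `\` simplex1]. *)
Definition g q : R :=
  if SB q <= RA q then RR q / RA q + (QQ q - RR q) / SB q
  else SS q / SB q + (QQ q - SS q) / RA q.

(** ** The exponents *)

(* [get P] is the element of [P] whenever [P] is a singleton.  All the
   equations below have exactly one real solution. *)
Definition t1 : R := get [set t : R | \sum_(i in J1) width i `^ t = 1].
Definition t2 : R := get [set t : R | \sum_(j in J2) height j `^ t = 1].

Definition D1 : R :=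
  get [set D : R | \sum_(l < nmap C) aa l `^ t1 * bb l `^ (D - t1) = 1].
Definition D2 : R :=
  get [set D : R | \sum_(l < nmap C) bb l `^ t2 * aa l `^ (D - t2) = 1].

Definition S1 l : R :=
  get [set S : R | \sum_(m in colset (col l)) bb m `^ S = 1].
Definition S2 l : R :=
  get [set S : R | \sum_(m in rowset (row l)) aa m `^ S = 1].

(* [sup] and [inf] are taken over finite nonempty sets, so they are the
   maximum and the minimum. *)
Definition E1 : R := if vertical_type then -1 else t1 + sup (range S1).
Definition E2 : R := if horizontal_type then -1 else t2 + sup (range S2).
Definition F1 : R := if vertical_type then 3 else t1 + inf (range S1).
Definition F2 : R := if horizontal_type then 3 else t2 + inf (range S2).

(** ** Fibre conditions *)

Definition unif_vertical : Prop :=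
  exists t : R, 0 <= t /\
    forall i, i \in J1 -> \sum_(l in colset i) bb l `^ t = 1.
Definition unif_horizontal : Prop :=
  exists t : R, 0 <= t /\
    forall j, j \in J2 -> \sum_(l in rowset j) aa l `^ t = 1.

Definition ufH : Prop :=
  ((exists2 q, simplex1 q & (g q)%:E = hausdorff_dim (attr C)) ->
     unif_vertical) /\
  ((exists2 q, simplex2 q & (g q)%:E = hausdorff_dim (attr C)) ->
     unif_horizontal).

Definition ufB : Prop :=
  [/\ D1 > D2 -> unif_vertical,
      D1 < D2 -> unif_horizontal &
      D1 = D2 -> unif_vertical \/ unif_horizontal].

Definition ufA : Prop :=
  [/\ E1 > E2 -> unif_vertical,
      E1 < E2 -> unif_horizontal &
      E1 = E2 -> unif_vertical \/ unif_horizontal].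

Definition ufL : Prop :=
  [/\ horizontal_type -> unif_vertical,
      vertical_type -> unif_horizontal &
      mixed_type -> [/\ unif_vertical, unif_horizontal & F1 = F2]].

End Carpet.

(* Main.v *)
From HB Require Import structures.
From mathcomp Require Import all_boot all_order all_algebra.
From mathcomp Require Import all_classical all_reals all_analysis.
From mathcomp Require Import ring lra.
Require Import Defs.
Set Implicit Arguments.
Unset Strict Implicit.
Unset Printing Implicit Defensive.
Import Order.TTheory GRing.Theory Num.Theory numFieldNormedType.Exports.
Local Open Scope classical_set_scope.
Local Open Scope ring_scope.

(** * Why the implications hold and are strict

    All four conditions compare a quantity attached to the columns with one
    attached to the rows, and exchanging the two axes exchanges them
    ([transpose]).  So it is enough to argue for columns.

    Suppose that the vertical fibres are uniform with exponent t.  Then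
    D1 = t1 + t, the fibre exponents S1 are all equal to t, and E1 = D1 unless
    the carpet is of vertical type.  In general D2 <= E2 unless the carpet is of
    horizontal type, in which case D2 <= D1 follows from b <= a and t <= t2.
    These comparisons give the first two implications ([ufL_ufA], [ufA_ufB]).

    The third one involves the true Hausdorff dimension, and rests on the lower
    bound dim K >= t1 + t for uniform fibres ([vertical_dim_ge]).  The Bernoulli measure with
    weights a^t1 b^t gives a box of sides alpha and beta a mass of order at most
    alpha^t1 beta^t, whatever its shape ([box_mass]), because the projection to
    the columns and every conditional measure on a vertical fibre satisfy a
    one-dimensional Frostman estimate ([mass_le]).  The mass distribution
    principle then bounds the dimension ([hausdorff_dim_ge]).

    On the other side Gibbs' inequality gives g <= D1 on [simplex1] and g <= D2 on
    [simplex2] ([gcol_le_D1], [grow_le_D2]).  If the vertical fibres are uniform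
    and D2 <= D1, a point q of [simplex2] with g q = dim K >= D1 must be an
    equality case of the second bound, and D1 = D2.  The equality cases
    ([gcol_eq_D1], [diagonal_case]) force uniform horizontal fibres, which is what
    the condition on the Hausdorff dimension asks for ([ufH_vertical]).

    The three strictness examples are explicit: [carpet1] is a diagonal pair of
    rectangles, [carpet2] has one rectangle in each column, [carpet3] one in each
    row.  In [carpet3] the dimension is at least t2 = D2, and an estimate of g on
    [simplex1] shows that the dimension is not reached there, although D1 > D2. *)

(** * Exponential sums and Gibbs' inequality *)

Lemma powR_lt_anti (R : realType) (b x y : R) :
  0 < b < 1 -> x < y -> b `^ y < b `^ x.
Proof.
move=> /[dup] b01 /andP[b0 _] xy; rewrite /powR gt_eqF// ltr_expR.
by rewrite ltr_nM2r// ln_lt0.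
Qed.

Lemma powR_le_anti (R : realType) (b x y : R) :
  0 < b < 1 -> x <= y -> b `^ y <= b `^ x.
Proof.
by move=> /andP[b0 b1]; apply: ger_powR; rewrite b0 ltW.
Qed.

Section ExpSum.
Variables (R : realType) (T : finType) (P : pred T) (c b : T -> R).
Hypothesis c_gt0 : forall l, P l -> 0 < c l.
Hypothesis b_itv : forall l, P l -> 0 < b l < 1.
Let f (x : R) := \sum_(l | P l) c l * b l `^ x.

Lemma expsum_lt (x y : R) (l0 : T) : P l0 -> x < y -> f y < f x.
Proof.
move=> Pl0 xy; rewrite /f (bigD1 l0)//= [ltRHS](bigD1 l0)//=.
apply: ltr_leD; first by rewrite ltr_pM2l ?c_gt0// powR_lt_anti ?b_itv.
apply: ler_sum => l /andP[Pl _].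
by rewrite ler_pM2l ?c_gt0// powR_le_anti ?b_itv// ltW.
Qed.

Lemma expsum_continuous : continuous f.
Proof.
move=> x; rewrite /f; apply: cvg_big; first exact: add_continuous.
move=> l Pl; apply: cvgM; first exact: cvg_cst.
rewrite /powR; have /andP[b0 _] := b_itv Pl; rewrite gt_eqF//.
apply: continuous_comp; first by apply: cvgM; [exact: cvg_id|exact: cvg_cst].
exact: continuous_expR.
Qed.

(** Intermediate values: a single summand takes the value 1 at some exponent, where
    the sum is at least 1, and for large exponents each of the n summands is at
    most 1 / n. *)
Lemma expsum_exists (l0 : T) : P l0 -> exists x, f x = 1.
Proof.
move=> Pl0.
have pw (l : T) (v : R) : P l -> 0 < v -> exists x, c l * b l `^ x = v.
  move=> Pl v0; have /andP[b0 b1] := b_itv Pl; exists (ln (v / c l) / ln (b l)).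
  rewrite /powR gt_eqF// divfK ?lt_eqF ?ln_lt0 ?b0// lnK ?posrE ?divr_gt0 ?c_gt0//.
  by rewrite mulrC divfK// gt_eqF ?c_gt0.
pose n : R := #|T|%:R.
have n0 : 0 < n by rewrite ltr0n; apply/card_gt0P; exists l0.
have [lo flo] : exists x, 1 <= f x.
  have [x ex] := pw l0 1 Pl0 ltr01; exists x.
  rewrite /f (bigD1 l0)//= ex lerDl sumr_ge0// => l /andP[Pl _].
  by rewrite mulr_ge0 ?powR_ge0 ?ltW ?c_gt0.
have [hi fhi] : exists x, f x <= 1.
  have : forall l, exists x, P l -> c l * b l `^ x <= n^-1.
    move=> l; case: (boolP (P l)) => [Pl|_]; last by exists 0.
    have [x ex] := @pw l n^-1 Pl ltac:(by rewrite invr_gt0).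
    by exists x; rewrite ex.
  move=> /choice[X hX]; exists (\big[Num.max/X l0]_l X l).
  apply: (@le_trans _ _ (\sum_(l : T) n^-1)); last first.
    by rewrite sumr_const -[X in X <= _]mulr_natl -/n divff// gt_eqF.
  rewrite /f big_mkcond; apply: ler_sum => l _; case: ifP => Pl; last first.
    by rewrite invr_ge0 ltW.
  apply: le_trans (hX l Pl); rewrite ler_pM2l ?c_gt0// powR_le_anti ?b_itv//.
  exact: le_bigmax.
have lohi : lo <= hi.
  rewrite leNgt; apply/negP => hl; have := expsum_lt Pl0 hl; lra.
have := @IVT _ f lo hi 1 lohi (continuous_subspaceT expsum_continuous).
case; first by rewrite ge_min le_max fhi flo orbT.
by move=> x _ fx; exists x.
Qed.

End ExpSum.

Section Gibbs.
Variables (R : realType) (T : finType) (P : pred T) (q p : T -> R).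
Hypothesis q_ge0 : forall l, P l -> 0 <= q l.
Hypothesis p_gt0 : forall l, P l -> 0 < p l.

(** This is ln x <= x - 1 at x = p l / q l.  The slack p l - q l disappears after
    summation. *)
Lemma gibbs_term (l : T) : P l -> q l * ln (p l) <= q l * ln (q l) + (p l - q l).
Proof.
move=> Pl; have := q_ge0 Pl; rewrite le_eqVlt => /predU1P[<-|q0].
  by rewrite !mul0r add0r subr0 ltW ?p_gt0.
have p0 := p_gt0 Pl.
have : ln (p l / q l) <= p l / q l - 1.
  have := @le_ln1Dx R (p l / q l - 1); rewrite [1 + _]addrC subrK; apply.
    by rewrite ltrBrDr addrC subrr divr_gt0.
rewrite ln_div ?posrE// -(ler_pM2l q0) mulrBr mulrBr mulr1 mulrC.
rewrite [X in _ <= X - _ -> _]mulrCA divff ?gt_eqF// mulr1; lra.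
Qed.

Lemma gibbs_term_eq (l : T) : P l ->
  q l * ln (p l) = q l * ln (q l) + (p l - q l) -> q l = p l.
Proof.
move=> Pl; have := q_ge0 Pl; have p0 := p_gt0 Pl.
rewrite le_eqVlt => /predU1P[<-|q0].
  by rewrite !mul0r add0r subr0 => p0'; rewrite -p0' ltxx in p0.
move=> e; apply/eqP; rewrite eq_sym; apply/negPn/negP => pq.
have : ln (p l / q l) < p l / q l - 1.
  have x0 : ln (p l / q l) != 0.
    rewrite ln_eq0 ?divr_gt0//; apply: contra pq => /eqP h.
    by rewrite -[p l](@divfK _ (q l)) ?h ?mul1r// gt_eqF.
  have := expR_gt1Dx x0; rewrite lnK ?posrE ?divr_gt0//; lra.
rewrite ln_div ?posrE// -(ltr_pM2l q0) !mulrBr mulr1.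
rewrite [X in _ < X - _ -> _]mulrCA divff ?gt_eqF// mulr1; lra.
Qed.

Hypothesis sums : \sum_(l | P l) p l <= \sum_(l | P l) q l.

(** Only the total masses of p and q are compared, so that the inequality can also
    be applied inside a single column, where they are not probability vectors. *)
Lemma gibbs : \sum_(l | P l) q l * ln (p l) <= \sum_(l | P l) q l * ln (q l).
Proof.
apply: (@le_trans _ _ (\sum_(l | P l) (q l * ln (q l) + (p l - q l)))).
  by apply: ler_sum => l; apply: gibbs_term.
by rewrite big_split/= sumrB gerDl subr_le0.
Qed.

Lemma gibbs_eq : \sum_(l | P l) q l * ln (p l) = \sum_(l | P l) q l * ln (q l) ->
  forall l, P l -> q l = p l.
Proof.
move=> e l Pl; apply: gibbs_term_eq => //.
pose d l := q l * ln (q l) + (p l - q l) - q l * ln (p l).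
have d0 l' : P l' -> 0 <= d l' by move=> Pl'; rewrite subr_ge0 gibbs_term.
have : \sum_(l | P l) d l <= 0.
  by rewrite /d sumrB big_split/= sumrB e addrAC subrr add0r subr_le0.
rewrite le_eqVlt ltNge sumr_ge0// orbF => /eqP /psumr_eq0P => /(_ d0 l Pl).
by rewrite /d => /eqP; rewrite subr_eq0 => /eqP ->.
Qed.

End Gibbs.

(** * Masses of intervals under inhomogeneous Bernoulli weights *)

Section WordSum.
Variable R : realType.

(** The weights may change from one letter to the next, since above a fixed
    sequence of columns the law of each row depends on the current column. *)
Fixpoint wsum (I : finType) (ws : seq (I -> R)) (F : seq I -> R) : R :=
  if ws is w :: ws' then \sum_i w i * wsum ws' (fun c => F (i :: c)) else F [::].

Variable I : finType.
Implicit Types (ws : seq (I -> R)) (F G : seq I -> R).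

Definition nonneg_weights ws := foldr (fun w P => (forall i, 0 <= w i) /\ P) True ws.

Lemma eq_wsum ws F G : F =1 G -> wsum ws F = wsum ws G.
Proof.
elim: ws F G => [|w ws IH] F G FG /=; first exact: FG.
by apply: eq_bigr => i _; congr (_ * _); apply: IH => c; apply: FG.
Qed.

Lemma wsum_le ws F G : nonneg_weights ws ->
  (forall c, size c = size ws -> F c <= G c) -> wsum ws F <= wsum ws G.
Proof.
elim: ws F G => [|w ws IH] F G /=; first by move=> _; exact.
move=> [w0 ws0] FG; apply: ler_sum => i _; apply: ler_wpM2l => //.
by apply: IH => // c cs; apply: FG; rewrite /= cs.
Qed.

Lemma wsumMr ws F (k : R) : wsum ws (fun c => F c * k) = wsum ws F * k.
Proof.
elim: ws F => [|w ws IH] F //=.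
by rewrite mulr_suml; apply: eq_bigr => i _; rewrite IH mulrA.
Qed.

Lemma wsum_sum (K : Type) (s : seq K) (P : pred K) (F : K -> seq I -> R) ws :
  wsum ws (fun c => \sum_(k <- s | P k) F k c) = \sum_(k <- s | P k) wsum ws (F k).
Proof.
elim: ws F => [|w ws IH] F //=.
rewrite exchange_big/=; apply: eq_bigr => i _.
by rewrite IH mulr_sumr.
Qed.

Lemma wsum0 ws : wsum ws (fun=> 0) = 0.
Proof. by elim: ws => [|w ws IH]//=; rewrite big1// => i _; rewrite IH mulr0. Qed.

Lemma wsum_ge0 ws F : nonneg_weights ws -> (forall c, 0 <= F c) -> 0 <= wsum ws F.
Proof. by move=> ws0 F0; rewrite -(wsum0 ws); apply: wsum_le => // c _. Qed.

End WordSum.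

Lemma sum_at_most_one (R : numDomainType) (J : finType) (P : pred J) (g : J -> R)
    (X : R) : 0 <= X -> (forall j, P j -> g j <= X) ->
  (forall j j', P j -> P j' -> g j != 0 -> g j' != 0 -> j = j') ->
  \sum_(j | P j) g j <= X.
Proof.
move=> X0 gX g1.
case: (pickP (fun j => P j && (g j != 0))) => [j /andP[Pj gj]|g0].
  rewrite (bigD1 j)//= big1 ?addr0 ?gX// => j' /andP[Pj' j'j].
  by apply/eqP; apply: contraNT j'j => gj'; apply/eqP/g1.
by rewrite big1// => j Pj; apply/eqP/negbFE; have := g0 j; rewrite Pj.
Qed.

Section IntervalMass.
Variables (R : realType) (J : finType) (e b : J -> R) (m rho t y0 : R).
Hypotheses (m_gt0 : 0 < m) (t_ge0 : 0 <= t) (y0_itv : 0 <= y0 <= 1).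
Hypothesis b_itv : forall j, m <= b j <= rho.
Hypothesis e_ge0 : forall j, 0 <= e j.
Hypothesis eb_le1 : forall j, e j + b j <= 1.
Hypothesis separated : forall j j', j != j' -> e j + b j <= e j' \/ e j' + b j' <= e j.

Definition word_point (c : seq J) : R := foldr (fun j y => b j * y + e j) y0 c.

(** The condition w j <= b j ^ t says that a first-level interval has at most the
    mass that dimension t allows for its length. *)
Definition frostman_weights (ws : seq (J -> R)) : Prop :=
  foldr (fun w P => ((forall j, 0 <= w j <= b j `^ t) /\ \sum_j w j <= 1) /\ P) True ws.

Definition mass (ws : seq (J -> R)) (u v : R) : R :=
  wsum ws (fun c => (u <= word_point c <= v)%R%:R).

Let b_gt0 j : 0 < b j.
Proof. by have /andP[+ _] := b_itv j; apply: lt_le_trans. Qed.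

Let frostman_nonneg ws : frostman_weights ws -> nonneg_weights ws.
Proof.
by elim: ws => //= w ws IH [[w0 _] /IH ?]; split=> // j; have /andP[] := w0 j.
Qed.

Lemma word_point_itv c : 0 <= word_point c <= 1.
Proof.
elim: c => //= j c /andP[p0 p1]; rewrite addr_ge0 ?mulr_ge0 ?(ltW (b_gt0 j))//=.
apply: le_trans (eb_le1 j); rewrite addrC lerD2l.
by rewrite -[leRHS]mulr1 ler_wpM2l ?(ltW (b_gt0 j)).
Qed.

Lemma mass_ge0 ws u v : frostman_weights ws -> 0 <= mass ws u v.
Proof. by move=> /frostman_nonneg/wsum_ge0; apply=> c; case: (_ <= _ <= _). Qed.

Lemma mass_le1 ws u v : frostman_weights ws -> mass ws u v <= 1.
Proof.
move=> wsF; apply: (@le_trans _ _ (wsum ws (fun=> 1))).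
  by apply: wsum_le (frostman_nonneg wsF) _ => c _; case: (_ <= _ <= _).
elim: ws wsF => //= w ws IH [[w0 w1] /IH wsF].
apply: le_trans w1; apply: ler_sum => j _.
by have /andP[wj _] := w0 j; rewrite -[leRHS]mulr1 ler_wpM2l.
Qed.

Lemma mass_cons w ws u v : mass (w :: ws) u v =
  \sum_j w j * mass ws ((u - e j) / b j) ((v - e j) / b j).
Proof.
apply: eq_bigr => j _; congr (_ * _); apply: eq_wsum => c /=.
by rewrite ler_pdivrMr// ler_pdivlMr// lerBlDr lerBrDr [_ * b j]mulrC.
Qed.

Lemma mass_out ws u v : v < 0 \/ 1 < u -> mass ws u v = 0.
Proof.
move=> uv; rewrite -[RHS](wsum0 ws); apply: eq_wsum => c.
have /andP[p0 p1] := word_point_itv c.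
case: uv => h; first by rewrite [_ <= v]leNgt (lt_le_trans h p0)/= andbF.
by rewrite [u <= _]leNgt (le_lt_trans p1 h).
Qed.

Let C1 := m^-1 `^ t.

Let C1_ge0 : 0 <= C1.
Proof. exact: powR_ge0. Qed.

Let rho_gt0 (j : J) : 0 < rho.
Proof. by apply: lt_le_trans (b_gt0 j) _; have /andP[] := b_itv j. Qed.

Lemma scale_bound (j : J) (C x : R) (N : nat) : 0 <= C -> 0 <= x ->
  b j `^ t * (C * (x / b j + rho ^+ N) `^ t) <= C * (x + rho ^+ N.+1) `^ t.
Proof.
move=> C0 x0; have bj := b_gt0 j; have r0 := rho_gt0 j.
have rN : 0 <= rho ^+ N by rewrite exprn_ge0// ltW.
rewrite mulrCA -powRM ?(ltW bj)//; last first.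
  by rewrite addr_ge0// divr_ge0// ltW.
apply: ler_wpM2l => //; apply: ge0_ler_powR => //; rewrite ?nnegrE.
- by rewrite mulr_ge0 ?(ltW bj)// addr_ge0// divr_ge0// ltW.
- by rewrite addr_ge0// exprn_ge0// ltW.
rewrite mulrDr mulrCA divff ?gt_eqF// mulr1 lerD2l exprS ler_wpM2r//.
by have /andP[] := b_itv j.
Qed.

(** Intervals at least as long as the shortest first-level interval are handled by
    the constant m^-1 ^ t alone. *)
Lemma large_bound (y M : R) : M <= 1 -> m <= y -> M <= C1 * y `^ t.
Proof.
move=> M1 my; apply: (le_trans M1).
have y0' : 0 <= y by apply: le_trans my; exact: ltW.
rewrite -powRM ?invr_ge0 ?(ltW m_gt0)//.
have {1}-> : 1 = 1 `^ t :> R by rewrite powR1.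
rewrite ge0_ler_powR// ?nnegrE ?mulr_ge0// ?invr_ge0 ?(ltW m_gt0)//.
by rewrite ler_pdivlMl// mulr1.
Qed.

Let powN_ge0 (N : nat) : J -> 0 <= rho ^+ N.
Proof. by move=> j; rewrite exprn_ge0// ltW// (rho_gt0 j). Qed.

Let powR_mono (x y : R) : 0 <= x -> x <= y -> x `^ t <= y `^ t.
Proof. by move=> x0 xy; rewrite ge0_ler_powR// nnegrE// (le_trans x0). Qed.

Let weight_term w j (M C x : R) N : (forall j, 0 <= w j <= b j `^ t) ->
  0 <= M -> 0 <= C -> 0 <= x ->
  M <= C * (x / b j + rho ^+ N) `^ t -> w j * M <= C * (x + rho ^+ N.+1) `^ t.
Proof.
move=> w0 M0 C0 x0 MC; have /andP[wj0 wj] := w0 j.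
by apply: le_trans (scale_bound j N C0 x0); apply: ler_pM.
Qed.

(** The interval is thought of as cut off by the left end of [0, 1].  If v < m it
    meets at most one first-level interval, and after rescaling that one it is again
    cut off on the left; so the constant does not deteriorate from level to level.
    The summand rho ^ N is there because words of length N do not resolve lengths
    below rho ^ N. *)
Lemma mass_left ws u v : m <= 1 -> frostman_weights ws -> 0 <= v ->
  mass ws u v <= C1 * (v + rho ^+ size ws) `^ t.
Proof.
move=> m1; elim: ws u v => [|w ws IH] u v wsF v0.
  by apply: large_bound; rewrite ?mass_le1//= expr0 (le_trans m1)// lerDr.
have := mass_le1 u v wsF; rewrite mass_cons => mass1.
have [wsE wsF'] := wsF; have [w0 w1] := wsE.
case: (pickP (@predT J)) => [j0 _|J0]; last first.
  by rewrite big1 ?mulr_ge0 ?powR_ge0// => j; have := J0 j.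
case: (lerP m v) => [mv|vm].
  by apply: large_bound => //; rewrite (le_trans mv)// lerDl powN_ge0.
apply: sum_at_most_one => [|j _|j j' _ _].
- by rewrite mulr_ge0 ?powR_ge0.
- case: (lerP 0 ((v - e j) / b j)) => [vj|vj]; last first.
    by rewrite mass_out ?mulr0 ?mulr_ge0 ?powR_ge0//; left.
  have vj' : 0 <= v - e j by move: vj; rewrite ler_pdivlMr// mul0r.
  apply: le_trans (weight_term (N := size ws) (x := v - e j) w0 _ C1_ge0 vj' _) _.
  + exact: mass_ge0.
  + exact: IH.
  + apply: ler_wpM2l => //; apply: powR_mono; first by rewrite addr_ge0 ?powN_ge0.
    by rewrite lerD2r gerBl.
- have ev i : w i * mass ws ((u - e i) / b i) ((v - e i) / b i) != 0 -> e i <= v.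
    move=> h; rewrite leNgt; apply/negP => vi; move/eqP: h; apply.
    rewrite mass_out ?mulr0//; left.
    by rewrite ltr_pdivrMr// mul0r subr_lt0.
  move=> /ev h /ev h'; apply/eqP/negPn/negP => /separated.
  have /andP[bj _] := b_itv j; have /andP[bj' _] := b_itv j'.
  by have := e_ge0 j; have := e_ge0 j'; lra.
Qed.

(** The mirror image of [mass_left], for intervals cut off at 1. *)
Lemma mass_right ws u v : m <= 1 -> frostman_weights ws -> u <= 1 ->
  mass ws u v <= C1 * (1 - u + rho ^+ size ws) `^ t.
Proof.
move=> m1; elim: ws u v => [|w ws IH] u v wsF u1.
  apply: large_bound; rewrite ?mass_le1//= expr0 (le_trans m1)// lerDr.
  by rewrite subr_ge0.
have := mass_le1 u v wsF; rewrite mass_cons => mass1.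
have [wsE wsF'] := wsF; have [w0 w1] := wsE.
case: (pickP (@predT J)) => [j0 _|J0]; last first.
  by rewrite big1 ?mulr_ge0 ?powR_ge0// => j; have := J0 j.
case: (lerP m (1 - u)) => [mv|vm].
  by apply: large_bound => //; rewrite (le_trans mv)// lerDl powN_ge0.
have scE i : 1 - (u - e i) / b i = (e i + b i - u) / b i.
  have bi : b i != 0 by rewrite gt_eqF.
  by field.
apply: sum_at_most_one => [|j _|j j' _ _].
- by rewrite mulr_ge0 ?powR_ge0.
- case: (lerP ((u - e j) / b j) 1) => [vj|vj]; last first.
    by rewrite mass_out ?mulr0 ?mulr_ge0 ?powR_ge0//; right.
  have vj' : 0 <= e j + b j - u by move: vj; rewrite ler_pdivrMr//; lra.
  apply: le_trans (weight_term (N := size ws) (x := e j + b j - u) w0 _ C1_ge0 vj' _) _.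
  + exact: mass_ge0.
  + by rewrite -scE; apply: IH.
  + apply: ler_wpM2l => //; apply: powR_mono; first by rewrite addr_ge0 ?powN_ge0.
    by rewrite lerD2r lerD2r.
- have ev i : w i * mass ws ((u - e i) / b i) ((v - e i) / b i) != 0 -> u <= e i + b i.
    move=> h; rewrite leNgt; apply/negP => vi; move/eqP: h; apply.
    rewrite mass_out ?mulr0//; right.
    by rewrite ltr_pdivlMr// mul1r; lra.
  move=> /ev h /ev h'; apply/eqP/negPn/negP => /separated.
  have /andP[bj _] := b_itv j; have /andP[bj' _] := b_itv j'.
  by have := eb_le1 j; have := eb_le1 j'; lra.
Qed.

(** An interval shorter than m either lies strictly inside one first-level
    interval, and is then rescaled without loss, or it contains endpoints of such
    intervals: at most one left endpoint and at most one right endpoint, as any two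
    of the same kind are at least m apart.  Each of the two pieces so obtained is
    one-sided, whence twice the one-sided constant. *)
Lemma mass_le ws u v : m <= 1 -> frostman_weights ws -> u <= v ->
  mass ws u v <= (C1 + C1) * (v - u + rho ^+ size ws) `^ t.
Proof.
move=> m1; elim: ws u v => [|w ws IH] u v wsF uv.
  apply: (@le_trans _ _ (C1 * (v - u + 1) `^ t)).
    by apply: large_bound; rewrite ?mass_le1//= (le_trans m1)// lerDr subr_ge0.
  by rewrite mulrDl lerDl mulr_ge0 ?powR_ge0.
have := mass_le1 u v wsF; rewrite mass_cons => mass1.
have [wsE wsF'] := wsF; have [w0 w1] := wsE.
have uv0 : 0 <= v - u by rewrite subr_ge0.
set X := _ `^ t; have X0 : 0 <= X by exact: powR_ge0.
case: (pickP (@predT J)) => [j0 _|J0]; last first.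
  by rewrite big1 ?mulr_ge0 ?addr_ge0// => j; have := J0 j.
case: (lerP m (v - u)) => [muv|uvm].
  apply: (@le_trans _ _ (C1 * X)); last by rewrite mulrDl lerDl mulr_ge0.
  by apply: large_bound => //; rewrite (le_trans muv)// lerDl powN_ge0.
pose g j := w j * mass ws ((u - e j) / b j) ((v - e j) / b j).
have scE i : (v - e i) / b i - (u - e i) / b i = (v - u) / b i.
  have bi : b i != 0 by rewrite gt_eqF.
  by field.
have meet j : g j != 0 -> e j <= v /\ u <= e j + b j.
  move=> h; split; rewrite leNgt; apply/negP => vi; move/eqP: h; apply.
    by rewrite /g mass_out ?mulr0//; left; rewrite ltr_pdivrMr// mul0r subr_lt0.
  by rewrite /g mass_out ?mulr0//; right; rewrite ltr_pdivlMr// mul1r; lra.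
case: (pickP (fun j => (e j < u) && (v < e j + b j))) => [j /andP[eju vej]|cut].
  apply: sum_at_most_one => [|i _|i i' _ _].
  - by rewrite mulr_ge0 ?addr_ge0.
  - apply: (weight_term w0) => //; rewrite ?mass_ge0 ?addr_ge0// -scE.
    by apply: IH => //; rewrite ler_pM2r ?invr_gt0// lerD2r.
  - have only k : g k != 0 -> k = j.
      move=> /meet[h1 h2]; apply/eqP/negPn/negP => /separated; lra.
    by move=> /only-> /only->.
have cutP j : g j != 0 -> u <= e j \/ e j + b j <= v.
  move=> _; have := cut j; case: (ltrP (e j) u) => [_|]; last by left.
  by rewrite /= ltNge => /negbFE; right.
have boundL j : u <= e j -> g j <= C1 * X.
  move=> uj; case: (lerP 0 ((v - e j) / b j)) => [vj|vj]; last first.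
    by rewrite /g mass_out ?mulr0 ?mulr_ge0//; left.
  have vj' : 0 <= v - e j by move: vj; rewrite ler_pdivlMr// mul0r.
  apply: le_trans (weight_term (N := size ws) (x := v - e j) w0 _ C1_ge0 vj' _) _.
  + exact: mass_ge0.
  + exact: mass_left.
  + apply: ler_wpM2l => //; apply: powR_mono; first by rewrite addr_ge0 ?powN_ge0.
    by rewrite lerD2r lerB.
have boundR j : e j + b j <= v -> g j <= C1 * X.
  move=> jv; case: (lerP ((u - e j) / b j) 1) => [vj|vj]; last first.
    by rewrite /g mass_out ?mulr0 ?mulr_ge0//; right.
  have vj' : 0 <= e j + b j - u by move: vj; rewrite ler_pdivrMr//; lra.
  apply: le_trans (weight_term (N := size ws) (x := e j + b j - u) w0 _ C1_ge0 vj' _) _.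
  + exact: mass_ge0.
  + have -> : (e j + b j - u) / b j = 1 - (u - e j) / b j.
      have bi : b j != 0 by rewrite gt_eqF.
      by field.
    exact: mass_right.
  + apply: ler_wpM2l => //; apply: powR_mono; first by rewrite addr_ge0 ?powN_ge0.
    by rewrite lerD2r lerB.
rewrite (bigID (fun j => u <= e j))/= mulrDl; apply: lerD.
  apply: sum_at_most_one => [|j uj|j j' uj uj' /meet[h1 h2] /meet[h1' h2']].
  - by rewrite mulr_ge0.
  - exact: boundL.
  - apply/eqP/negPn/negP => /separated.
    have /andP[bj _] := b_itv j; have /andP[bj' _] := b_itv j'; lra.
apply: sum_at_most_one => [|j uj|j j' uj uj' gj gj'].
- by rewrite mulr_ge0.
- case: (eqVneq (g j) 0) => [gj|/cutP[]]; last exact: boundR.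
    by rewrite -/(g j) gj mulr_ge0.
  by move=> h; rewrite h in uj.
- have [h|h] := cutP _ gj; first by rewrite h in uj.
  have [h'|h'] := cutP _ gj'; first by rewrite h' in uj'.
  have [_ k] := meet _ gj; have [_ k'] := meet _ gj'.
  apply/eqP/negPn/negP => /separated.
  have /andP[bj _] := b_itv j; have /andP[bj' _] := b_itv j'; lra.
Qed.

End IntervalMass.

(** * The Bernoulli measure of a box *)

Section Factor.
Variables (R : realType) (T I J : finType) (c : T -> I) (r : T -> J).
Variables (x : I -> R) (z : J -> R).

(** When (c, r) is injective this is z j or 0: the law of the row, given that the
    column is i. *)
Definition fibre_weight (i : I) (j : J) : R :=
  \sum_(l | (c l == i) && (r l == j)) z j.

Lemma fibre_weight_sum i (G : J -> R) :
  \sum_j fibre_weight i j * G j = \sum_(l | c l == i) z (r l) * G (r l).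
Proof.
rewrite [RHS](partition_big r predT)//=; apply: eq_bigr => j _.
by rewrite mulr_suml; apply: eq_bigr => l /andP[_ /eqP ->].
Qed.

(** A word of maps is a word of columns together with a word of rows.  Summing over
    the rows first leaves, for each word of columns, an inhomogeneous Bernoulli sum
    over the rows. *)
Lemma wsum_factor N (X : seq I -> R) (Y : seq J -> R) :
  wsum (nseq N (fun l => x (c l) * z (r l))) (fun w => X (map c w) * Y (map r w)) =
  wsum (nseq N x) (fun k => X k * wsum (map fibre_weight k) Y).
Proof.
elim: N X Y => [|N IH] X Y //=.
rewrite (partition_big c predT)//=; apply: eq_bigr => i _.
under eq_bigr => l /eqP li.
  rewrite (IH (fun k => X (c l :: k)) (fun k => Y (r l :: k))) li -mulrA.
  over.
rewrite -mulr_sumr; congr (_ * _).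
transitivity (wsum (nseq N x) (fun k => \sum_(l | c l == i)
    (X (i :: k) * wsum (map fibre_weight k) (fun y => Y (r l :: y))) * z (r l))).
  rewrite wsum_sum; apply: eq_bigr => l _.
  by rewrite wsumMr mulrC.
apply: eq_wsum => k.
rewrite (fibre_weight_sum i (fun j => wsum (map fibre_weight k) (fun y => Y (j :: y)))).
by rewrite mulr_sumr; apply: eq_bigr => l _; rewrite mulrAC mulrA.
Qed.

End Factor.

Section Offset.
Variables (R : realType) (n : nat) (w : 'I_n -> R).
Hypotheses (w_itv : forall i, 0 < w i < 1) (w_sum : \sum_i w i = 1).

Definition offset (i : 'I_n) : R := \sum_(i' < n | (i' < i)%N) w i'.

Let w_ge0 i : 0 <= w i.
Proof. by have /andP[/ltW] := w_itv i. Qed.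

Lemma offset_ge0 i : 0 <= offset i.
Proof. by apply: sumr_ge0 => j _. Qed.

Lemma offset_step (i i' : 'I_n) : (i < i')%N -> offset i + w i <= offset i'.
Proof.
move=> ii'; rewrite addrC /offset [leRHS](bigD1 i)//= lerD2l.
rewrite [leRHS](bigID (fun j : 'I_n => (j < i)%N))/= -[leLHS]addr0.
apply: lerD; last by apply: sumr_ge0 => j _.
rewrite le_eqVlt; apply/orP; left; apply/eqP; apply: eq_bigl => j.
case: (ltnP j i) => ji; rewrite ?andbF// andbT (ltn_trans ji ii')/=.
by apply/esym; rewrite -(inj_eq val_inj)/= ltn_eqF.
Qed.

Lemma offset_le1 i : offset i + w i <= 1.
Proof.
rewrite addrC -w_sum [leRHS](bigD1 i)//= lerD2l.
rewrite [leRHS](bigID (fun j : 'I_n => (j < i)%N))/= -[leLHS]addr0.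
apply: lerD; last by apply: sumr_ge0 => j _.
rewrite le_eqVlt; apply/orP; left; apply/eqP; apply: eq_bigl => j.
case: (ltnP j i) => ji; rewrite ?andbF// andbT.
by apply/esym; rewrite -(inj_eq val_inj)/= ltn_eqF.
Qed.

Lemma offset_separated i i' : i != i' ->
  offset i + w i <= offset i' \/ offset i' + w i' <= offset i.
Proof.
by rewrite neq_ltn => /orP[] /offset_step; [left|right].
Qed.

End Offset.

Lemma uniform_bounds (R : realType) (T : finType) (w : T -> R) :
  (forall i, 0 < w i < 1) ->
  exists m rho : R, [/\ 0 < m <= 1, 0 < rho < 1 & forall i, m <= w i <= rho].
Proof.
move=> w01; exists (\big[Num.min/1]_i w i), (\big[Num.max/2^-1]_i w i); split.
- rewrite bigmin_le_id andbT; apply: lt_bigmin => // i _.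
  by have /andP[] := w01 i.
- apply/andP; split.
    by apply: lt_le_trans (bigmax_ge_id _ _ _ _); lra.
  by apply: bigmax_lt => [|i _]; [lra|have /andP[] := w01 i].
- by move=> i; rewrite le_bigmax andbT bigmin_le.
Qed.

Section Boxes.
Variables (R : realType) (C : carpet R) (s t : R) (p : R * R).
Hypotheses (s_ge0 : 0 <= s) (t_ge0 : 0 <= t).
Hypotheses (p1 : 0 <= p.1 <= 1) (p2 : 0 <= p.2 <= 1).
Hypothesis columns : \sum_(i in J1 C) width i `^ s = 1.
Hypothesis fibres : forall i, i \in J1 C -> \sum_(l in colset i) bb l `^ t = 1.

Definition word_image (w : seq 'I_(nmap C)) : R * R := foldr (@psi R C) p w.

Definition in_box (u v u' v' : R) (y : R * R) : bool :=
  (u <= y.1 <= v) && (u' <= y.2 <= v').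

Let q (l : 'I_(nmap C)) : R := aa l `^ s * bb l `^ t.

Lemma col_J1 (l : 'I_(nmap C)) : col l \in J1 C.
Proof. by rewrite inE; apply/finset.set0Pn; exists l; rewrite inE. Qed.

Lemma bernoulli_sum : \sum_l q l = 1.
Proof.
rewrite -columns (partition_big (@col _ C) (mem (J1 C)))/=; last by move=> l _; exact: col_J1.
apply: eq_bigr => i iJ; rewrite -[RHS]mulr1 -(fibres iJ) mulr_sumr.
apply: eq_big => l; first by rewrite [RHS]inE.
by move=> /eqP <-.
Qed.

Lemma bernoulli_total N : wsum (nseq N q) (fun=> 1) = 1.
Proof.
elim: N => //= N IH; rewrite -[RHS]bernoulli_sum.
by apply: eq_bigr => l _; rewrite IH mulr1.
Qed.

Lemma bernoulli_nonneg N : nonneg_weights (nseq N q).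
Proof. by elim: N => //= N IH; split=> // l; rewrite mulr_ge0 ?powR_ge0. Qed.

Let x (i : 'I_(ncol C)) : R := if i \in J1 C then width i `^ s else 0.

Let z (j : 'I_(nrow C)) : R := height j `^ t.

Lemma word_imageE w : word_image w =
  (word_point (offset (@width _ C)) (@width _ C) p.1 (map (@col _ C) w),
   word_point (offset (@height _ C)) (@height _ C) p.2 (map (@row _ C) w)).
Proof.
by elim: w => /= [|l w ->]; [case: p|rewrite /psi /aa /bb].
Qed.

Lemma fibre_frostman (k : seq 'I_(ncol C)) :
  frostman_weights (@height _ C) t (map (fibre_weight (@col _ C) (@row _ C) z) k).
Proof.
elim: k => //= i k IH; split=> //; split=> [j|].
  rewrite /fibre_weight sumr_ge0/=; last by move=> *; exact: powR_ge0.
  apply: sum_at_most_one; rewrite ?powR_ge0// => l l' /andP[/eqP li /eqP lj].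
  move=> /andP[/eqP li' /eqP lj'] _ _; apply: (@pos_inj _ C).
  by apply/eqP; rewrite -pair_eqE/= /pair_eq -/(col l) -/(row l) -/(col l') -/(row l')
    li lj li' lj' !eqxx.
have -> : \sum_j fibre_weight (@col _ C) (@row _ C) z i j =
    \sum_(l in colset i) bb l `^ t.
  transitivity (\sum_j fibre_weight (@col _ C) (@row _ C) z i j * 1).
    by apply: eq_bigr => j _; rewrite mulr1.
  rewrite fibre_weight_sum; apply: eq_big => l; first by rewrite inE.
  by rewrite mulr1.
case: (boolP (i \in J1 C)) => [/fibres->//|iJ].
rewrite big1// => l li; exfalso; move/negP: iJ; apply.
by move: li; rewrite inE => /eqP <-; exact: col_J1.
Qed.

Lemma column_frostman N : frostman_weights (@width _ C) s (nseq N x).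
Proof.
elim: N => //= N IH; split=> //; split=> [i|].
  by rewrite /x; case: ifP => _; rewrite ?powR_ge0 ?lexx.
by rewrite /x -big_mkcond/= columns.
Qed.

(** The row estimate is the same for all words of columns, because the fibres are
    uniform; so it can be pulled out of the sum over the columns.  The box has
    arbitrary proportions, which covers words along which widths and heights shrink
    at quite different rates, in either order. *)
Lemma box_mass : exists M rho : R, [/\ 0 < M, 0 < rho < 1 &
  forall N u v u' v', u <= v -> u' <= v' ->
  wsum (nseq N q) (fun w => (in_box u v u' v' (word_image w))%:R) <=
  M * (v - u + rho ^+ N) `^ s * (v' - u' + rho ^+ N) `^ t].
Proof.
have [m [r [/andP[m0 m1] /andP[r0 r1] mr]]] := uniform_bounds (@width_itv _ C).
have [m' [r' [/andP[m0' m1'] /andP[r0' r1'] mr']]] := uniform_bounds (@height_itv _ C).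
pose rho := Num.max r r'.
have rho0 : 0 < rho by rewrite lt_max r0.
pose M1 := m^-1 `^ s + m^-1 `^ s; pose M2 := m'^-1 `^ t + m'^-1 `^ t.
have M10 : 0 < M1 by rewrite addr_gt0// powR_gt0// invr_gt0.
have M20 : 0 < M2 by rewrite addr_gt0// powR_gt0// invr_gt0.
exists (M1 * M2), rho; split.
- exact: mulr_gt0.
- by rewrite rho0 gt_max r1.
move=> N u v u' v' uv uv'.
pose X k : R := (u <= word_point (offset (@width _ C)) (@width _ C) p.1 k <= v)%R%:R.
pose Y k : R := (u' <= word_point (offset (@height _ C)) (@height _ C) p.2 k <= v')%R%:R.
have -> : wsum (nseq N q) (fun w => (in_box u v u' v' (word_image w))%:R) =
    wsum (nseq N (fun l => x (col l) * z (row l)))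
      (fun w => X (map (@col _ C) w) * Y (map (@row _ C) w)).
  have -> : (fun l => x (col l) * z (row l)) = q.
    by apply/funext => l; rewrite /x col_J1.
  by apply: eq_wsum => w; rewrite word_imageE /in_box/= /X /Y -natrM mulnb.
rewrite wsum_factor.
have mr2 j : m <= @width _ C j <= rho.
  by have /andP[-> h] := mr j; rewrite le_max h.
have mr2' j : m' <= @height _ C j <= rho.
  by have /andP[-> h] := mr' j; rewrite le_max h orbT.
have rN k : 0 <= rho ^+ k by rewrite exprn_ge0// ltW.
have Yle k : size k = N ->
    wsum (map (fibre_weight (@col _ C) (@row _ C) z) k) Y <= M2 * (v' - u' + rho ^+ N) `^ t.
  move=> kN; have := mass_le m0' t_ge0 p2 mr2' (offset_ge0 (@height_itv _ C))
    (offset_le1 (@height_itv _ C) (@height_sum _ C))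
    (offset_separated (@height_itv _ C)) m1' (fibre_frostman k) uv'.
  by rewrite size_map kN.
have Xle := mass_le m0 s_ge0 p1 mr2 (offset_ge0 (@width_itv _ C))
    (offset_le1 (@width_itv _ C) (@width_sum _ C))
    (offset_separated (@width_itv _ C)) m1 (column_frostman N) uv.
rewrite size_nseq in Xle.
apply: (@le_trans _ _ (wsum (nseq N x)
    (fun k => X k * (M2 * (v' - u' + rho ^+ N) `^ t)))); last first.
  rewrite wsumMr; apply: (@le_trans _ _
    ((M1 * (v - u + rho ^+ N) `^ s) * (M2 * (v' - u' + rho ^+ N) `^ t))).
    by rewrite ler_wpM2r// mulr_ge0 ?powR_ge0// ltW.
  by rewrite le_eqVlt; apply/orP; left; apply/eqP; ring.
apply: wsum_le => [|k]; last first.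
  by rewrite size_nseq => /Yle; apply: ler_wpM2l; rewrite /X ler0n.
by elim: (N) => //= N' IH; split=> // i; rewrite /x; case: ifP; rewrite ?powR_ge0.
Qed.

End Boxes.

(** * Lower bound for the Hausdorff dimension *)

Section Attractor.
Variables (R : realType) (C : carpet R).
Let K := attr C.

Lemma attr_psi (l : 'I_(nmap C)) p : K p -> K (psi l p).
Proof.
have [_ _ KE] := attrP C; move=> Kp; by rewrite /K KE; exists l.
Qed.

Lemma attr_inv p : K p -> exists (l : 'I_(nmap C)) p', K p' /\ p = psi l p'.
Proof.
by have [_ _ KE] := attrP C; rewrite {1}/K KE => -[l _ [p' Kp' <-]]; exists l, p'.
Qed.

Lemma attr_word_image p w : K p -> K (@word_image R C p w).
Proof. by move=> Kp; elim: w => //= l w; exact: attr_psi. Qed.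

Lemma affine_max_le1 (w : R) (e M : R) : 0 < w < 1 -> e + w <= 1 -> M <= w * M + e -> M <= 1.
Proof.
move=> /andP[w0 w1] ew h; rewrite -(@ler_pM2l _ (1 - w)) ?subr_gt0//; lra.
Qed.

Lemma affine_min_ge0 (w : R) (e m : R) : 0 < w < 1 -> 0 <= e -> w * m + e <= m -> 0 <= m.
Proof.
move=> /andP[w0 w1] ew h; rewrite -(@ler_pM2l _ (1 - w)) ?subr_gt0//; lra.
Qed.

(** The maximum M of a coordinate over the attractor is attained in some
    [psi l @` attr C], so M <= w M + e with e + w <= 1; likewise for the minimum. *)
Lemma attr_unit_square p : K p -> (0 <= p.1 <= 1) && (0 <= p.2 <= 1).
Proof.
have [K0 Kc _] := attrP C; move=> Kp.
have cfst : {within K, continuous (fst : R * R -> R)}.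
  by apply: continuous_subspaceT => x; exact: cvg_fst.
have csnd : {within K, continuous (snd : R * R -> R)}.
  by apply: continuous_subspaceT => x; exact: cvg_snd.
have o0 := offset_ge0; have o1 := offset_le1.
have bound (f : R * R -> R) (w e : 'I_(nmap C) -> R) : {within K, continuous f} ->
    (forall l y, f (psi l y) = w l * f y + e l) ->
    (forall l, 0 < w l < 1) -> (forall l, 0 <= e l) -> (forall l, e l + w l <= 1) ->
    0 <= f p <= 1.
  move=> cf fE w01 e0 e1.
  have [a /set_mem Ka amin] := compact_EVT_min K0 Kc cf.
  have [b /set_mem Kb bmax] := compact_EVT_max K0 Kc cf.
  have [l [a' [Ka' aE]]] := attr_inv Ka; have [l' [b' [Kb' bE]]] := attr_inv Kb.
  have fa : 0 <= f a.
    apply: (affine_min_ge0 (w01 l) (e0 l)); rewrite {2}aE fE lerD2r.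
    rewrite ler_wpM2l//; first by have /andP[/ltW] := w01 l.
    exact/amin/mem_set.
  have fb : f b <= 1.
    apply: (affine_max_le1 (w01 l') (e1 l')); rewrite {1}bE fE lerD2r.
    rewrite ler_wpM2l//; first by have /andP[/ltW] := w01 l'.
    exact/bmax/mem_set.
  by rewrite (le_trans fa) ?(le_trans _ fb)//; [exact/bmax/mem_set|exact/amin/mem_set].
apply/andP; split.
- apply: (bound fst (@aa _ C) (fun l => offset (@width _ C) (col l))) => // l.
  + exact: width_itv.
  + exact/offset_ge0/width_itv.
  + apply: offset_le1; [exact: width_itv|exact: width_sum].
- apply: (bound snd (@bb _ C) (fun l => offset (@height _ C) (row l))) => // l.
  + exact: height_itv.
  + exact/offset_ge0/height_itv.
  + apply: offset_le1; [exact: height_itv|exact: height_sum].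
Qed.

End Attractor.

(** A set of diameter r lies in the box of half-side r around any of its points.
    Here x stands for r ^ d, which is at most r ^ d' because r <= 1. *)
Lemma diam_piece (R : realType) (U : set (R * R)) (d d' : R) :
  0 < d -> 0 <= d' <= d -> (diam U <= 1)%E ->
  exists x z, [/\ 0 <= x, (x%:E <= diam_pow d' U)%E &
    forall y, U y -> `|z.1 - y.1| <= x `^ d^-1 /\ `|z.2 - y.2| <= x `^ d^-1].
Proof.
move=> d0 /andP[d'0 d'd] U1.
have [U0|/set0P[z Uz]] := eqVneq U set0.
  exists 0, (0, 0); split=> //.
  - by rewrite /diam_pow asboolT.
  - by move=> y; rewrite U0.
have diam0 : (0 <= diam U)%E.
  apply: ereal_sup_ubound; exists z => //; exists z => //.
  by rewrite /dist2 !subrr !expr0n/= addr0 sqrtr0.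
have fdiam : diam U \is a fin_num by rewrite ge0_fin_numE// (le_lt_trans U1)// ltry.
pose r := fine (diam U).
have r0 : 0 <= r by exact: fine_ge0.
have r1 : r <= 1 by rewrite -lee_fin fineK.
exists (r `^ d), z; split.
- exact: powR_ge0.
- rewrite /diam_pow asboolF; last by move=> U0; rewrite U0 in Uz.
  rewrite -(fineK fdiam) poweR_EFin lee_fin -/r.
  have [->|rn0] := eqVneq r 0.
    by rewrite powR0 ?gt_eqF// powR_ge0.
  by apply: ger_powR => //; rewrite lt_neqAle eq_sym rn0 r0.
- move=> y Uy; rewrite -powRrM divff ?gt_eqF// powRr1//.
  have dle : dist2 z y <= r.
    rewrite -lee_fin fineK//; apply: ereal_sup_ubound; exists z => //.
    by exists y.
  split; apply: le_trans dle; rewrite /dist2 -sqrtr_sqr ler_wsqrtr//.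
  + by rewrite lerDl sqr_ge0.
  + by rewrite lerDr sqr_ge0.
Qed.

Lemma sum_pow2_le (R : realType) (n : nat) : \sum_(0 <= k < n) (2^-1 : R) ^+ k.+1 <= 1.
Proof.
suff -> : \sum_(0 <= k < n) (2^-1 : R) ^+ k.+1 = 1 - 2^-1 ^+ n.
  by rewrite gerBl exprn_ge0.
elim: n => [|n IH]; first by rewrite big_nil expr0 subrr.
by rewrite big_nat_recr//= IH exprS; field.
Qed.

Section HausdorffLower.
Variables (R : realType) (C : carpet R) (s t : R).
Hypotheses (s_ge0 : 0 <= s) (t_ge0 : 0 <= t) (st_gt0 : 0 < s + t).
Hypothesis columns : \sum_(i in J1 C) width i `^ s = 1.
Hypothesis fibres : forall i, i \in J1 C -> \sum_(l in colset i) bb l `^ t = 1.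
Let K := attr C.

(** The mass distribution principle for finitely many boxes: at a level N with
    rho ^ N below all radii, the N-cylinders have total mass 1 and each contains a
    point of the attractor, so the masses of the boxes add up to at least 1. *)
Lemma finite_cover_bound : exists2 c : R, 0 < c &
  forall (D : seq nat) (z : nat -> R * R) (r : nat -> R), (forall k, 0 < r k) ->
  (forall y, K y -> exists2 k, k \in D & ball (z k) (r k) y) ->
  c <= \sum_(k <- D) r k `^ (s + t).
Proof.
have [[p Kp] _ _] := attrP C.
have /andP[p1 p2] := attr_unit_square Kp.
have [M [rho [M0 /andP[rho0 rho1] boxM]]] := box_mass s_ge0 t_ge0 p1 p2 columns fibres.
exists (M * 3 `^ (s + t))^-1; first by rewrite invr_gt0 mulr_gt0// powR_gt0.
move=> D z r r0 cov.
have [r' r'0 r'r] : exists2 r', 0 < r' & forall k, k \in D -> r' <= r k.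
  elim: {cov} D => [|k D [r' r'0 IH]]; first by exists 1.
  exists (Num.min (r k) r') => [|k']; first by rewrite lt_min r0.
  by rewrite inE => /predU1P[->|/IH h]; rewrite ge_min ?lexx// h orbT.
have [N rhoN] : exists N, rho ^+ N <= r'.
  have rho_lt1 : `|rho| < 1 by rewrite ger0_norm// ltW.
  have := cvg_expr rho_lt1; move=> /cvgrPdist_le /(_ _ r'0)[N _ /(_ N)] h.
  exists N; have := h (leqnn N); rewrite /= sub0r normrN ger0_norm//.
  by rewrite exprn_ge0// ltW.
set q := fun l : 'I_(nmap C) => aa l `^ s * bb l `^ t.
rewrite -[leLHS]mul1r ler_pdivrMr ?mulr_gt0 ?powR_gt0//.
rewrite -{1}(bernoulli_total columns fibres N) -/q.
pose box k w := in_box ((z k).1 - r k) ((z k).1 + r k) ((z k).2 - r k) ((z k).2 + r k)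
   (@word_image R C p w).
apply: (@le_trans _ _ (wsum (nseq N q) (fun w => \sum_(k <- D) (box k w)%:R))).
  apply: wsum_le; first exact: bernoulli_nonneg.
  move=> w _; have [k kD [/= b1 b2]] := cov _ (attr_word_image w Kp).
  rewrite (big_rem k)//= -[leLHS]addr0 lerD ?sumr_ge0//.
  have -> // : box k w.
  rewrite /box /in_box; move: b1 b2; rewrite /ball/= !ltr_distlC.
  by move=> /andP[/ltW -> /ltW ->] /andP[/ltW -> /ltW ->].
rewrite wsum_sum mulr_suml big_seq [leRHS]big_seq; apply: ler_sum => k kD.
apply: le_trans (boxM _ _ _ _ _ _ _) _.
- by rewrite lerD2l; have := r0 k; lra.
- by rewrite lerD2l; have := r0 k; lra.
have rk := r0 k; have rN := le_trans rhoN (r'r k kD).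
have rN0 : 0 <= rho ^+ N by rewrite exprn_ge0// ltW.
rewrite [leRHS]mulrCA -!mulrA ler_pM2l//.
rewrite -powRM ?(ltW rk)// powRD; last by apply/implyP => _; rewrite mulf_neq0// gt_eqF.
apply: ler_pM; rewrite ?powR_ge0//.
- by rewrite ge0_ler_powR ?nnegrE//; lra.
- by rewrite ge0_ler_powR ?nnegrE//; lra.
Qed.

(** A countable cover is replaced by open boxes that are so little larger that the
    sum of their powers grows by at most c / 2; compactness then leaves finitely
    many of them. *)
Lemma hausdorff_dim_ge : ((s + t)%:E <= hausdorff_dim (attr C))%E.
Proof.
have [c c0 cP] := finite_cover_bound.
have [_ Kc _] := attrP C.
apply: le_ereal_inf_tmp => _ [d' /= [d'0 H0] <-]; rewrite lee_fin leNgt.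
apply/negP => d'd.
suff : ((c / 2)%:E <= hausdorff_measure d' K)%E.
  by rewrite H0 lee_fin leNgt divr_gt0.
apply: (@le_trans _ _ (hausdorff_pre d' 1 K)); last first.
  by apply: ereal_sup_ubound; exists 1 => //; exact: ltr01.
apply: le_ereal_inf_tmp => _ [U [U1 Ucov] <-].
have dd' : 0 <= d' <= s + t by rewrite d'0 ltW.
have /choice[x /choice[z xz]] k := diam_piece st_gt0 dd' (U1 k).
(* The radius is chosen through its power, which exceeds that of the piece by eps k. *)
pose eps k : R := c / 2 * 2^-1 ^+ k.+1.
have eps0 k : 0 < eps k by rewrite mulr_gt0 ?exprn_gt0// divr_gt0.
pose r k := (x k + eps k) `^ (s + t)^-1.
have xe0 k : 0 < x k + eps k by have [x0 _ _] := xz k; rewrite ltr_wpDl.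
have r0 k : 0 < r k by rewrite powR_gt0.
have [n Dcov] : exists n, forall y, K y -> exists2 k, (k < n)%N & ball (z k) (r k) y.
  have := (iffLR (compact_near_coveringP K)) Kc nat \oo
    (fun n y => exists2 k, (k < n)%N & ball (z k) (r k) y) _.
  case=> [y Ky|N _ NP]; last by exists N; exact: (NP N (leqnn N)).
  have [k _ Uky] := Ucov _ Ky.
  have [x0 _ /(_ _ Uky)[h1 h2]] := xz k.
  have lt_r : x k `^ (s + t)^-1 < r k.
    rewrite /r gt0_ltr_powR ?invr_gt0// ?nnegrE// ?ltrDl//.
    exact: ltW.
  have zy : ball (z k) (r k) y.
    by split; rewrite /ball/=; [exact: le_lt_trans h1 lt_r|exact: le_lt_trans h2 lt_r].
  exists (ball (z k) (r k), [set n | (k < n)%N]).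
    split; first exact: open_nbhs_nbhs (conj (ball_open _ _) zy).
    by exists k.+1.
  by move=> [y' n] [/= zy' kn]; exists k.
have {}cP := cP (index_iota 0 n) z r r0.
have {cP} : c <= \sum_(0 <= k < n) r k `^ (s + t).
  by apply: cP => y /Dcov[k kn ky]; exists k => //; rewrite mem_index_iota.
have -> : \sum_(0 <= k < n) r k `^ (s + t) = \sum_(0 <= k < n) (x k + eps k).
  apply: eq_bigr => k _.
  by rewrite /r -powRrM mulVf ?gt_eqF// powRr1// ltW.
move=> cle.
have {cle} : c <= \sum_(0 <= k < n) x k + c / 2.
  apply: (le_trans cle).
  rewrite big_split/= lerD2l -mulr_sumr ler_piMr ?divr_ge0 ?(ltW c0)//.
  exact: sum_pow2_le.
move=> cle; have {}cle : c / 2 <= \sum_(0 <= k < n) x k by lra.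
apply: (@le_trans _ _ (\sum_(0 <= k < n) diam_pow d' (U k))%E).
  apply: (@le_trans _ _ (\sum_(0 <= k < n) (x k)%:E)%E).
    by rewrite sumEFin lee_fin.
  by apply: lee_sum => k _; have [] := xz k.
apply: nneseries_lim_ge => k _ _; have [x0 xU _] := xz k.
by apply: le_trans xU; rewrite lee_fin.
Qed.

End HausdorffLower.

(** * Exponents *)

Section Monotone.
Variables (R : realType) (T : finType) (P : pred T) (c b : T -> R).
Hypothesis c_gt0 : forall l, P l -> 0 < c l.
Hypothesis b_itv : forall l, P l -> 0 < b l < 1.

Lemma expsum_leE (l0 : T) x y : P l0 ->
  (\sum_(l | P l) c l * b l `^ x <= \sum_(l | P l) c l * b l `^ y) = (y <= x).
Proof.
move=> Pl0; case: (ltgtP x y) => [xy|yx|->]; last by rewrite lexx.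
- by apply/negbTE; rewrite -ltNge; exact: (expsum_lt c_gt0 b_itv Pl0 xy).
- exact: ltW (expsum_lt c_gt0 b_itv Pl0 yx).
Qed.

End Monotone.

Section PowerSum.
Variables (R : realType) (T : finType) (P : pred T) (b : T -> R) (l0 : T).
Hypothesis b_itv : forall l, P l -> 0 < b l < 1.
Hypothesis Pl0 : P l0.

Let powsumE x : \sum_(l | P l) b l `^ x = \sum_(l | P l) 1 * b l `^ x.
Proof. by apply: eq_bigr => l _; rewrite mul1r. Qed.

Lemma powsum_root :
  \sum_(l | P l) b l `^ (get [set x | \sum_(l | P l) b l `^ x = 1]) = 1.
Proof.
have [x xE] := expsum_exists (fun _ _ => ltr01) b_itv Pl0.
apply: (@getPex _ [set x | \sum_(l | P l) b l `^ x = 1]).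
by exists x; rewrite /= powsumE.
Qed.

Lemma powsum_le1E x y : \sum_(l | P l) b l `^ y = 1 ->
  (\sum_(l | P l) b l `^ x <= 1) = (y <= x).
Proof. by move=> <-; rewrite !powsumE (expsum_leE (fun _ _ => ltr01) b_itv _ _ Pl0). Qed.

Lemma powsum_inj x y :
  \sum_(l | P l) b l `^ x = 1 -> \sum_(l | P l) b l `^ y = 1 -> x = y.
Proof.
move=> gx gy; apply/eqP; rewrite eq_le.
by rewrite -(powsum_le1E x gy) -(powsum_le1E y gx) gx gy lexx.
Qed.

Lemma powsum_root_ge0 x : \sum_(l | P l) b l `^ x = 1 -> 0 <= x.
Proof.
move=> gx; rewrite leNgt; apply/negP => x0.
have : 1 < \sum_(l | P l) b l `^ x.
  rewrite (bigD1 l0)//=; apply: ltr_wpDr.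
    by apply: sumr_ge0 => *; exact: powR_ge0.
  by rewrite -(powRr0 (b l0)) powR_lt_anti ?b_itv.
by rewrite gx ltxx.
Qed.

End PowerSum.

Section Exponents.
Variables (R : realType) (C : carpet R).
Implicit Types (l : 'I_(nmap C)) (i : 'I_(ncol C)).

Definition map0 : 'I_(nmap C) := Ordinal (ltnW (nmap_ge2 C)).

Lemma aa_itv l : 0 < aa l < 1. Proof. exact: width_itv. Qed.
Lemma bb_itv l : 0 < bb l < 1. Proof. exact: height_itv. Qed.
Lemma aa_gt0 l : 0 < aa l. Proof. by have /andP[] := aa_itv l. Qed.
Lemma bb_gt0 l : 0 < bb l. Proof. by have /andP[] := bb_itv l. Qed.

Lemma in_colset l i : (l \in colset i) = (col l == i).
Proof. by rewrite inE. Qed.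

Lemma row_J2 l : row l \in J2 C.
Proof. by rewrite inE; apply/finset.set0Pn; exists l; rewrite inE. Qed.

Lemma J1P i : reflect (exists l, col l = i) (i \in J1 C).
Proof.
rewrite inE; apply: (iffP (finset.set0Pn _)) => -[l].
  by rewrite in_colset => /eqP; exists l.
by move=> /eqP li; exists l; rewrite in_colset.
Qed.

Lemma sum_columns (F : 'I_(nmap C) -> R) :
  \sum_l F l = \sum_(i in J1 C) \sum_(l in colset i) F l.
Proof.
rewrite (partition_big (@col _ C) (mem (J1 C)))/=; last by move=> l _; exact: col_J1.
by apply: eq_bigr => i _; apply: eq_bigl => l; rewrite [RHS]inE.
Qed.

Lemma row_inj_column i : {in colset i &, injective (@row _ C)}.
Proof.
move=> l l'; rewrite !in_colset => /eqP li /eqP li' rl.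
apply: (@pos_inj _ C); apply/eqP; rewrite -pair_eqE/= /pair_eq.
by rewrite -/(col l) -/(row l) -/(col l') -/(row l') li li' rl !eqxx.
Qed.

(** Two maps in the same column lie in different rows. *)
Lemma column_sum_le i (F : 'I_(nrow C) -> R) : (forall j, 0 <= F j) ->
  \sum_(l in colset i) F (row l) <= \sum_(j in J2 C) F j.
Proof.
move=> F0; rewrite -(big_imset F (@row_inj_column i))/=.
rewrite [leRHS](bigID (mem [set row l | l in colset i]%SET))/=.
rewrite -[leLHS]addr0 lerD// ?sumr_ge0//.
rewrite le_eqVlt; apply/orP; left; apply/eqP; apply: eq_bigl => j.
case: (boolP (j \in _)) => [/imsetP[l _ ->]|_]; last by rewrite andbF.
by rewrite row_J2.
Qed.

Let width_itvJ i : i \in J1 C -> 0 < width i < 1.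
Proof. by move=> _; exact: width_itv. Qed.

Lemma t1P : \sum_(i in J1 C) width i `^ t1 C = 1.
Proof. exact: (powsum_root width_itvJ (col_J1 map0)). Qed.

Lemma t1E t : \sum_(i in J1 C) width i `^ t = 1 -> t1 C = t.
Proof. exact: (powsum_inj width_itvJ (col_J1 map0) t1P). Qed.

Lemma t1_ge0 : 0 <= t1 C.
Proof. exact: (powsum_root_ge0 width_itvJ (col_J1 map0) t1P). Qed.

Let bb_itvJ l m : m \in colset (col l) -> 0 < bb m < 1.
Proof. by move=> _; exact: bb_itv. Qed.

Let self_col l : l \in colset (col l).
Proof. by rewrite in_colset. Qed.

Let w1_gt0 l : true -> 0 < aa l `^ t1 C.
Proof. by move=> _; rewrite powR_gt0 ?aa_gt0. Qed.

Let bb_itvT l : true -> 0 < bb l < 1.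
Proof. by move=> _; exact: bb_itv. Qed.

Let f1sum x := \sum_(l < nmap C) aa l `^ t1 C * bb l `^ (x - t1 C).

Lemma D1P : f1sum (D1 C) = 1.
Proof.
have [x xE] := @expsum_exists _ _ predT _ _ w1_gt0 bb_itvT map0 isT.
apply: (@getPex _ [set D | f1sum D = 1]); exists (x + t1 C).
by rewrite /= /f1sum addrK.
Qed.

Lemma D1_leE x : (f1sum x <= 1) = (D1 C <= x).
Proof.
rewrite -{1}D1P /f1sum (@expsum_leE _ _ predT _ _ w1_gt0 bb_itvT map0 _ _ isT).
by rewrite lerD2r.
Qed.

Lemma D1_geE x : (1 <= f1sum x) = (x <= D1 C).
Proof.
rewrite -{1}D1P /f1sum (@expsum_leE _ _ predT _ _ w1_gt0 bb_itvT map0 _ _ isT).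
by rewrite lerD2r.
Qed.

Lemma D1E x : f1sum x = 1 -> D1 C = x.
Proof. by move=> fx; apply/eqP; rewrite eq_le -D1_leE -D1_geE fx lexx. Qed.

Definition vertical_fibres (t : R) :=
  forall i, i \in J1 C -> \sum_(l in colset i) bb l `^ t = 1.

(** With uniform fibres the weights a^s b^t split as column times fibre, so that the
    equation for D1 reduces to the one for t1. *)
Lemma sum_product (s t : R) : vertical_fibres t ->
  \sum_(l < nmap C) aa l `^ s * bb l `^ t = \sum_(i in J1 C) width i `^ s.
Proof.
move=> vt; rewrite sum_columns; apply: eq_bigr => i iJ.
rewrite -[RHS]mulr1 -(vt i iJ) mulr_sumr; apply: eq_bigr => l.
by rewrite in_colset => /eqP <-.
Qed.

Lemma D1_vertical t : vertical_fibres t -> D1 C = t1 C + t.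
Proof.
by move=> vt; apply: D1E; rewrite /f1sum addrAC subrr add0r sum_product// t1P.
Qed.

Lemma vertical_fibre_ge0 t : vertical_fibres t -> 0 <= t.
Proof.
by move=> /(_ _ (col_J1 map0)); exact: (powsum_root_ge0 (@bb_itvJ map0) (self_col map0)).
Qed.

Lemma D1_gt0 t : vertical_fibres t -> 0 < t1 C + t.
Proof.
move=> vt; have t0 := vertical_fibre_ge0 vt.
rewrite lt_neqAle addr_ge0 ?t1_ge0// andbT; apply/eqP => /esym/eqP.
rewrite paddr_eq0 ?t1_ge0// => /andP[/eqP t10 /eqP t0'].
have := sum_product (t1 C) vt; rewrite t1P t10 t0'.
under eq_bigr do rewrite !powRr0 mulr1.
rewrite sumr_const card_ord => /eqP; rewrite pnatr_eq1.
by have := nmap_ge2 C; case: (nmap C) => [|[|]].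
Qed.

Lemma S1P l : \sum_(m in colset (col l)) bb m `^ S1 l = 1.
Proof. exact: (powsum_root (@bb_itvJ l) (self_col l)). Qed.

Lemma S1_inj l x : \sum_(m in colset (col l)) bb m `^ x = 1 -> S1 l = x.
Proof. exact: (powsum_inj (@bb_itvJ l) (self_col l) (S1P l)). Qed.

Lemma S1_ge0 l : 0 <= S1 l.
Proof. exact: (powsum_root_ge0 (@bb_itvJ l) (self_col l) (S1P l)). Qed.

Lemma S1_le_sup l : S1 l <= sup (range (@S1 _ C)).
Proof.
apply: ub_le_sup; last by exists l.
exists (\big[Num.max/0]_(l < nmap C) S1 l) => _ [l' _ <-].
exact: le_bigmax.
Qed.

Lemma range_S1_vertical t : vertical_fibres t -> range (@S1 _ C) = [set t].
Proof.
move=> vt; apply/seteqP; split=> [_ [l _ <-]|_ ->] /=.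
  by apply: S1_inj; apply: vt; exact: col_J1.
by exists map0 => //; apply: S1_inj; apply: vt; exact: col_J1.
Qed.

Lemma S1_vertical t : vertical_fibres t -> sup (range (@S1 _ C)) = t.
Proof. by move=> /range_S1_vertical ->; exact: sup1. Qed.

(** Raising all fibre exponents to the largest one can only decrease the sums over
    the columns, which are 1 at the individual exponents. *)
Lemma D1_le_E1 : D1 C <= t1 C + sup (range (@S1 _ C)).
Proof.
rewrite -D1_leE /f1sum addrAC subrr add0r sum_columns -t1P.
apply: ler_sum => i /J1P[l <-]; rewrite -[leRHS]mulr1 -(S1P l) mulr_sumr.
apply: ler_sum => m; rewrite in_colset => /eqP lm.
by rewrite /aa lm ler_wpM2l ?powR_ge0// powR_le_anti ?bb_itv ?S1_le_sup.
Qed.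

Lemma E1_ge0 : ~~ vertical_type C -> 0 <= E1 C.
Proof.
move=> /negbTE vC; rewrite /E1 vC addr_ge0 ?t1_ge0//.
exact: le_trans (S1_ge0 map0) (S1_le_sup map0).
Qed.

Lemma horizontal_not_vertical : horizontal_type C -> ~~ vertical_type C.
Proof.
move=> /forallP h; apply/negP => /forallP v.
by have [l /negP] := aa_neq_bb C; apply; rewrite eq_le h v.
Qed.

End Exponents.

(** * Exchanging the two axes *)

Section Transpose.
Variable R : realType.

Definition swap (p : R * R) : R * R := (p.2, p.1).

Lemma swapK : involutive swap.
Proof. by case. Qed.

Lemma swap_preimageK (A : set (R * R)) : swap @^-1` (swap @^-1` A) = A.
Proof. by apply/seteqP; split=> p; rewrite /= swapK. Qed.

Lemma swap_continuous : continuous swap.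
Proof.
move=> p; apply: (@cvg_pair _ _ _ _ (nbhs p.2) (nbhs p.1)).
- exact: cvg_snd.
- exact: cvg_fst.
Qed.

Lemma image_swap (A : set (R * R)) : swap @` A = swap @^-1` A.
Proof.
apply/seteqP; split=> [_ [p Ap <-]|p Ap] /=; first by rewrite swapK.
by exists (swap p) => //; rewrite swapK.
Qed.

Lemma diam_swap (U : set (R * R)) : diam (swap @^-1` U) = diam U.
Proof.
rewrite /diam; congr ereal_sup; apply/seteqP; split=> _ [x Ux [y Uy <-]].
  by exists (swap x) => //; exists (swap y) => //; rewrite /dist2 addrC.
exists (swap x); rewrite /= ?swapK//; exists (swap y); rewrite /= ?swapK//.
by rewrite /dist2 addrC.
Qed.

Lemma diam_pow_swap d (U : set (R * R)) : diam_pow d (swap @^-1` U) = diam_pow d U.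
Proof.
rewrite /diam_pow diam_swap; congr (if _ then _ else _); apply: asbool_equiv_eq.
split=> [U0|->]; last by rewrite preimage_set0.
by rewrite -(swap_preimageK U) U0 preimage_set0.
Qed.

Lemma hausdorff_pre_swap_le d delta (A : set (R * R)) :
  (hausdorff_pre d delta (swap @^-1` A) <= hausdorff_pre d delta A)%E.
Proof.
apply: ereal_inf_le_tmp => _ [U [Ud AU] <-]; exists (fun k => swap @^-1` U k).
  split=> [k|p /AU[k _ Uk]]; first by rewrite diam_swap.
  by exists k.
by apply: eq_eseriesr => k _; rewrite diam_pow_swap.
Qed.

Lemma hausdorff_dim_swap (A : set (R * R)) :
  hausdorff_dim (swap @^-1` A) = hausdorff_dim A.
Proof.
have preE d delta B : hausdorff_pre d delta (swap @^-1` B) = hausdorff_pre d delta B.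
  apply: le_anti; rewrite hausdorff_pre_swap_le/=.
  by rewrite -{1}(swap_preimageK B) hausdorff_pre_swap_le.
have mE d : hausdorff_measure d (swap @^-1` A) = hausdorff_measure d A.
  by rewrite /hausdorff_measure; congr ereal_sup; apply: eq_imagel => delta _.
by rewrite /hausdorff_dim; congr ereal_inf; congr image; apply/funext => d /=; rewrite mE.
Qed.

Lemma transpose_pos_inj (C : baranski_ifs R) :
  injective (fun l : 'I_(nmap C) => ((pos l).2, (pos l).1)).
Proof.
move=> l l' [e2 e1]; apply: (@pos_inj _ C).
by rewrite [pos l]surjective_pairing e1 e2 -surjective_pairing.
Qed.

Lemma transpose_nmap_le (C : baranski_ifs R) : (nmap C <= nrow C * ncol C)%N.
Proof. by rewrite mulnC; exact: nmap_le. Qed.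

Definition transpose_ifs (C : baranski_ifs R) : baranski_ifs R :=
  BaranskiIFS (nrow_ge2 C) (ncol_ge2 C) (nmap_ge2 C) (transpose_nmap_le C)
    (@height_itv _ C) (@width_itv _ C) (height_sum C) (width_sum C)
    (@transpose_pos_inj C).

Lemma transpose_attractor (C : carpet R) :
  is_attractor (transpose_ifs C) (swap @^-1` attr C).
Proof.
have [[p Kp] Kc KE] := attrP C; split.
- by exists (swap p); rewrite /= swapK.
- rewrite -image_swap; apply: continuous_compact => //.
  exact/continuous_subspaceT/swap_continuous.
- rewrite {1}KE; apply/seteqP; split=> p'.
    by move=> [l _ [y Ky ye]]; exists l => //; exists (swap y);
       rewrite /= ?swapK// -[RHS]swapK -ye.
  by move=> [l _ [y Ky <-]]; exists l => //; exists (swap y).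
Qed.

Lemma transpose_neq (C : carpet R) :
  exists l : 'I_(nmap (transpose_ifs C)), aa l != bb l.
Proof. by have [l lE] := aa_neq_bb C; exists l; rewrite eq_sym. Qed.

Lemma transpose_not_vertical (C : carpet R) :
  ~ exists c : R, (swap @^-1` attr C) `<=` [set p | p.1 = c].
Proof.
move=> [c h]; apply: (attr_not_horizontal (c := C)); exists c => p Kp.
by apply: (h (swap p)); rewrite /= swapK.
Qed.

Lemma transpose_not_horizontal (C : carpet R) :
  ~ exists c : R, (swap @^-1` attr C) `<=` [set p | p.2 = c].
Proof.
move=> [c h]; apply: (attr_not_vertical (c := C)); exists c => p Kp.
by apply: (h (swap p)); rewrite /= swapK.
Qed.

(** Rows of C are columns of [transpose C], and each definition about rows unfolds
    to the definition about columns of the transposed carpet.  Hence every statement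
    about rows below is obtained by conversion. *)
Definition transpose (C : carpet R) : carpet R :=
  Carpet (transpose_attractor C) (transpose_neq C)
    (@transpose_not_vertical C) (@transpose_not_horizontal C).

End Transpose.

(** * Maximising g *)

Section Entropy.
Variables (R : realType) (C : carpet R) (q : 'I_(nmap C) -> R).
Hypothesis q_simplex : simplex q.

Let q_ge0 l : 0 <= q l. Proof. by have [+ _] := q_simplex; apply. Qed.
Let q_sum : \sum_l q l = 1. Proof. by have [] := q_simplex. Qed.

Let weighted_ln_lt0 (p : 'I_(nmap C) -> R) : (forall l, 0 < p l < 1) ->
  \sum_l q l * ln (p l) < 0.
Proof.
move=> p01; have ln_p l : ln (p l) < 0 by exact: ln_lt0 (p01 l).
have [l ql] : exists l, 0 < q l.
  apply: contrapT => h; have : \sum_l q l <= 0.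
    by apply: sumr_le0 => l _; rewrite leNgt; apply/negP => ql; apply: h; exists l.
  by rewrite q_sum ler10.
rewrite (bigD1 l)//= ltr_wnDr//; last by rewrite pmulr_rlt0.
by apply: sumr_le0 => l' _; rewrite mulr_ge0_le0// ltW.
Qed.

Lemma RA_lt0 : RA q < 0.
Proof. exact: weighted_ln_lt0 (@aa_itv _ C). Qed.

Lemma SB_lt0 : SB q < 0.
Proof. exact: weighted_ln_lt0 (@bb_itv _ C). Qed.

Lemma Rcol_ge0 i : 0 <= Rcol q i.
Proof. exact: sumr_ge0. Qed.

Lemma Rcol_out i : i \notin J1 C -> Rcol q i = 0.
Proof.
move=> iJ; rewrite /Rcol big1// => l; rewrite in_colset => /eqP li.
by move/negP: iJ; case; rewrite -li col_J1.
Qed.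

Lemma Rcol_sum : \sum_(i in J1 C) Rcol q i = 1.
Proof. by rewrite -q_sum sum_columns. Qed.

Lemma RR_J1 : RR q = \sum_(i in J1 C) Rcol q i * ln (Rcol q i).
Proof.
rewrite /RR (bigID (mem (J1 C)))/= [X in _ + X]big1 ?addr0// => i iJ.
by rewrite Rcol_out// mul0r.
Qed.

Lemma sum_columns_ln (F : 'I_(ncol C) -> R) :
  \sum_(i in J1 C) Rcol q i * F i = \sum_l q l * F (col l).
Proof.
rewrite sum_columns; apply: eq_bigr => i _; rewrite /Rcol mulr_suml.
by apply: eq_bigr => l; rewrite in_colset => /eqP ->.
Qed.

Lemma RR_ge (w : 'I_(ncol C) -> R) : (forall i, i \in J1 C -> 0 < w i) ->
  \sum_(i in J1 C) w i <= 1 -> \sum_l q l * ln (w (col l)) <= RR q.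
Proof.
move=> w0 w1; rewrite -(sum_columns_ln (fun i => ln (w i))) RR_J1; apply: gibbs => //.
- by move=> i _; exact: Rcol_ge0.
- by rewrite Rcol_sum.
Qed.

(** Gibbs' inequality against the weights a_i^t1 that define t1. *)
Lemma RR_ge_t1 : t1 C * RA q <= RR q.
Proof.
have := @RR_ge (fun i => width i `^ t1 C); rewrite t1P => /(_ _ (lexx _)) h.
apply: le_trans (h _) => [|i _]; last by have /andP[w0 _] := width_itv i; rewrite powR_gt0.
rewrite /RA mulr_sumr; apply: ler_sum => l _.
by rewrite ln_powR mulrCA.
Qed.

Lemma RR_eq_t1 : RR q = t1 C * RA q ->
  forall i, i \in J1 C -> Rcol q i = width i `^ t1 C.
Proof.
move=> RRE; apply: gibbs_eq.
- by move=> i _; exact: Rcol_ge0.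
- by move=> i _; have /andP[w0 _] := width_itv i; rewrite powR_gt0.
- by rewrite t1P Rcol_sum.
rewrite -RR_J1 RRE /RA mulr_sumr (sum_columns_ln (fun i => ln (width i `^ t1 C))).
by apply: eq_bigr => l _; rewrite ln_powR mulrCA.
Qed.

Let opt (l : 'I_(nmap C)) := aa l `^ t1 C * bb l `^ (D1 C - t1 C).

Let opt_gt0 l : 0 < opt l.
Proof. by rewrite mulr_gt0// powR_gt0 ?aa_gt0 ?bb_gt0. Qed.

Let opt_ln : \sum_l q l * ln (opt l) = t1 C * RA q + (D1 C - t1 C) * SB q.
Proof.
rewrite /RA /SB !mulr_sumr -big_split/=; apply: eq_bigr => l _.
rewrite lnM ?posrE ?powR_gt0 ?aa_gt0 ?bb_gt0// !ln_powR mulrDr.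
by congr (_ + _); rewrite mulrCA.
Qed.

(** Gibbs' inequality against the weights a^t1 b^(D1 - t1) that define D1. *)
Lemma QQ_ge_D1 : t1 C * RA q + (D1 C - t1 C) * SB q <= QQ q.
Proof.
rewrite -opt_ln; apply: gibbs => [l _|l _|]; [exact: q_ge0|exact: opt_gt0|].
by rewrite q_sum D1P.
Qed.

Lemma QQ_eq_D1 : QQ q = t1 C * RA q + (D1 C - t1 C) * SB q ->
  forall l, q l = aa l `^ t1 C * bb l `^ (D1 C - t1 C).
Proof.
move=> QE l; have := @gibbs_eq _ _ predT q opt; apply => //.
by rewrite q_sum D1P.
by rewrite opt_ln -QE.
Qed.

(** The formula that defines g on [simplex1], on the whole simplex. *)
Definition gcol : R := RR q / RA q + (QQ q - RR q) / SB q.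

(* D1 - gcol is a combination of the two Gibbs defects.  The first coefficient is
   nonnegative exactly when SB q <= RA q. *)
Let gcolE : D1 C - gcol =
  (RR q - t1 C * RA q) * ((RA q - SB q) / (RA q * SB q)) +
  (QQ q - (t1 C * RA q + (D1 C - t1 C) * SB q)) / - SB q.
Proof.
rewrite /gcol; have := RA_lt0; have := SB_lt0 => hB hA.
by field; rewrite !lt_eqF.
Qed.

Lemma gcol_le_D1 : SB q <= RA q -> gcol <= D1 C.
Proof.
move=> BA; have hA := RA_lt0; have hB := SB_lt0.
rewrite -subr_ge0 gcolE; apply: addr_ge0; apply: mulr_ge0.
- by rewrite subr_ge0 RR_ge_t1.
- by apply: divr_ge0; [rewrite subr_ge0|rewrite nmulr_lge0// ltW].
- by rewrite subr_ge0 QQ_ge_D1.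
- by rewrite invr_ge0 oppr_ge0 ltW.
Qed.

(** Both Gibbs defects vanish, except that the one of the columns has coefficient
    zero when SB q = RA q.  If both vanish, dividing the weights a^t1 b^(D1 - t1) of
    a column by their sum a^t1 shows that the fibres are uniform. *)
Lemma gcol_eq_D1 : SB q <= RA q -> gcol = D1 C ->
  (forall l, q l = aa l `^ t1 C * bb l `^ (D1 C - t1 C)) /\
  (SB q < RA q -> vertical_fibres C (D1 C - t1 C)).
Proof.
move=> BA gE; have hA := RA_lt0; have hB := SB_lt0.
have r0 : 0 <= RR q - t1 C * RA q by rewrite subr_ge0 RR_ge_t1.
have k0 : 0 <= (RA q - SB q) / (RA q * SB q).
  by apply: divr_ge0; [rewrite subr_ge0|rewrite nmulr_lge0// ltW].
have s0 : 0 <= QQ q - (t1 C * RA q + (D1 C - t1 C) * SB q).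
  by rewrite subr_ge0 QQ_ge_D1.
have B0 : 0 < (- SB q)^-1 by rewrite invr_gt0 oppr_gt0.
have := gcolE; rewrite gE subrr => /esym/eqP.
rewrite (paddr_eq0 (mulr_ge0 r0 k0) (mulr_ge0 s0 (ltW B0))) => /andP[e1 e2].
have qE : forall l, q l = aa l `^ t1 C * bb l `^ (D1 C - t1 C).
  apply: QQ_eq_D1; apply/eqP; rewrite -subr_eq0.
  by move: e2; rewrite mulf_eq0 (gt_eqF B0) orbF.
split=> // BA' i iJ.
have RE : Rcol q i = width i `^ t1 C.
  apply: RR_eq_t1 => //; apply/eqP; rewrite -subr_eq0.
  move: e1; rewrite mulf_eq0 [X in _ || X]gt_eqF ?orbF//.
  by rewrite divr_gt0 ?subr_gt0// nmulr_rgt0.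
have w0 : 0 < width i `^ t1 C.
  by have /andP[w0 _] := width_itv i; rewrite powR_gt0.
have wn0 : width i `^ t1 C != 0 by rewrite gt_eqF.
apply: (mulfI wn0); rewrite mulr1 -[RHS]RE /Rcol mulr_sumr.
by apply: eq_bigr => l; rewrite qE in_colset => /eqP <-.
Qed.

End Entropy.

(** * Comparing the four conditions *)

Section Implications.
Variable R : realType.
Implicit Type C : carpet R.

Lemma g_transpose C q : g (C := transpose C) q = g (C := C) q.
Proof.
transitivity (if RA (C := C) q <= SB (C := C) q
  then SS (C := C) q / SB (C := C) q + (QQ (C := C) q - SS (C := C) q) / RA (C := C) q
  else RR (C := C) q / RA (C := C) q + (QQ (C := C) q - RR (C := C) q) / SB (C := C) q).
  by [].
by rewrite /g; case: ltgtP => // ->; rewrite -!mulrDl ![_ + (_ - _)]addrC !subrK.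
Qed.

Lemma ufH_transpose C : ufH (transpose C) -> ufH C.
Proof.
have dimE : hausdorff_dim (attr (transpose C)) = hausdorff_dim (attr C).
  exact: hausdorff_dim_swap.
rewrite /ufH dimE => -[h1 h2]; split=> -[q qs gq].
- by apply: h2; exists q; rewrite ?g_transpose.
- by apply: h1; exists q; rewrite ?g_transpose.
Qed.

Lemma unif_verticalP C : unif_vertical C -> exists t, vertical_fibres C t.
Proof. by move=> [t [_ h]]; exists t. Qed.

Lemma vertical_dim_ge C t : vertical_fibres C t ->
  ((t1 C + t)%:E <= hausdorff_dim (attr C))%E.
Proof.
move=> vt; apply: hausdorff_dim_ge => //.
- exact: t1_ge0.
- exact: vertical_fibre_ge0 vt.
- exact: D1_gt0.
- exact: t1P.
Qed.

(** On the boundary SB q = RA q the extremal weights of both bounds coincide, and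
    comparing them at a map with a <> b gives D = t1 + t2.  Then the weights
    a^t1 b^t2 of the occupied cells have sum 1, as have those of all cells in the
    occupied columns and rows; so every such cell is occupied. *)
Lemma diagonal_case C (D : R) (q : 'I_(nmap C) -> R) : \sum_l q l = 1 ->
  (forall l, q l = aa l `^ t1 C * bb l `^ (D - t1 C)) ->
  (forall l, q l = bb l `^ t2 C * aa l `^ (D - t2 C)) ->
  unif_vertical C.
Proof.
move=> q1 qE qE'; have [l lE] := aa_neq_bb C.
have DE : D = t1 C + t2 C.
  have := qE l; rewrite qE' => /(congr1 (@ln R)).
  rewrite !lnM ?posrE ?powR_gt0 ?aa_gt0 ?bb_gt0// !ln_powR => e.
  have : (t1 C + t2 C - D) * (ln (aa l) - ln (bb l)) = 0 by lra.
  move=> /eqP; rewrite mulf_eq0 !subr_eq0 => /orP[/eqP //|/eqP e'].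
  by move: lE; rewrite (ln_inj _ _ e') ?eqxx// posrE ?aa_gt0 ?bb_gt0.
have w0 (i : 'I_(ncol C)) : 0 <= width i `^ t1 C by exact: powR_ge0.
have t2C : \sum_(j in J2 C) height j `^ t2 C = 1 by exact: (t1P (transpose C)).
have le1 (i : 'I_(ncol C)) : \sum_(l in colset i) bb l `^ t2 C <= 1.
  by have := column_sum_le i (fun j => powR_ge0 (@height _ C j) (t2 C)); rewrite t2C.
have : \sum_(i in J1 C) width i `^ t1 C * (1 - \sum_(l in colset i) bb l `^ t2 C) = 0.
  under eq_bigr do rewrite mulrBr mulr1.
  rewrite sumrB t1P -q1 sum_columns; apply/eqP; rewrite subr_eq0; apply/eqP.
  apply: eq_bigr => i _; rewrite mulr_sumr; apply: eq_bigr => m.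
  rewrite in_colset => /eqP <-; rewrite qE DE -/(aa m); congr (_ * _ `^ _); ring.
move=> /psumr_eq0P h.
exists (t2 C); split=> [|i iJ]; first exact: (t1_ge0 (transpose C)).
have /eqP := h (fun i _ => mulr_ge0 (w0 i) (etrans (subr_ge0 _ _) (le1 i))) i iJ.
rewrite mulf_eq0 => /orP[|/eqP]; last by lra.
by rewrite gt_eqF// powR_gt0//; have /andP[] := width_itv i.
Qed.

Lemma t2P C : \sum_(j in J2 C) height j `^ t2 C = 1.
Proof. exact: (t1P (transpose C)). Qed.

Lemma D2_leE C x :
  (\sum_(l < nmap C) bb l `^ t2 C * aa l `^ (x - t2 C) <= 1) = (D2 C <= x).
Proof. exact: (D1_leE (transpose C)). Qed.

Lemma D2_le_E2 C : ~~ horizontal_type C -> D2 C <= E2 C.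
Proof. by move=> /negbTE hC; rewrite /E2 hC; exact: (D1_le_E1 (transpose C)). Qed.

Lemma grow_le_D2 C (q : 'I_(nmap C) -> R) : simplex q -> RA q <= SB q -> 
  SS q / SB q + (QQ q - SS q) / RA q <= D2 C.
Proof. exact: (@gcol_le_D1 _ (transpose C)). Qed.

Lemma grow_eq_D2 C (q : 'I_(nmap C) -> R) : simplex q -> RA q <= SB q -> 
  SS q / SB q + (QQ q - SS q) / RA q = D2 C ->
  (forall l, q l = bb l `^ t2 C * aa l `^ (D2 C - t2 C)) /\
  (RA q < SB q -> unif_horizontal C).
Proof.
move=> qs AB gE; have [qE h] := @gcol_eq_D1 _ (transpose C) _ qs AB gE.
split=> // /h fib; exists (D2 C - t2 C); split; last exact: fib.
exact: vertical_fibre_ge0 fib.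
Qed.

Lemma diagonal_case_row C (D : R) (q : 'I_(nmap C) -> R) : \sum_l q l = 1 ->
  (forall l, q l = bb l `^ t2 C * aa l `^ (D - t2 C)) ->
  (forall l, q l = aa l `^ t1 C * bb l `^ (D - t1 C)) ->
  unif_horizontal C.
Proof. exact: (@diagonal_case (transpose C)). Qed.

Lemma g_row C (q : 'I_(nmap C) -> R) : RA q <= SB q ->
  g q = SS q / SB q + (QQ q - SS q) / RA q.
Proof.
by rewrite /g; case: ltgtP => // ->; rewrite -!mulrDl ![_ + (_ - _)]addrC !subrK.
Qed.

(** A q in [simplex2] with g q = dim K satisfies D1 <= dim K = g q <= D2 <= D1, so it
    is an equality case for the rows.  If RA q < SB q this gives uniform horizontal
    fibres at once; if RA q = SB q it is an equality case for the columns too. *)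
Lemma ufH_vertical C : unif_vertical C -> D2 C <= D1 C -> ufH C.
Proof.
move=> uC D21; split=> // -[q [q1 AB] gE].
have [t vt] := unif_verticalP uC.
have geD1 : D1 C <= g q.
  by rewrite -lee_fin gE (D1_vertical vt) vertical_dim_ge.
have gT := g_row AB; have le2 := grow_le_D2 q1 AB.
rewrite -gT in le2.
have DE : D1 C = D2 C.
  by apply/le_anti; rewrite D21 (le_trans geD1 le2).
have eq2 : g q = D2 C by apply/le_anti; rewrite le2 -DE.
have [qE fib] := grow_eq_D2 q1 AB (etrans (esym gT) eq2).
have [/fib//|BA] := ltP (RA q) (SB q).
have eq1 : gcol q = D1 C by rewrite DE -eq2 /g BA.
have [qE' _] := gcol_eq_D1 q1 BA eq1.
rewrite DE in qE'; have [_ sumq] := q1.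
exact: (diagonal_case_row sumq qE qE').
Qed.

Lemma ufH_horizontal C : unif_horizontal C -> D1 C <= D2 C -> ufH C.
Proof. by move=> uC D12; apply/ufH_transpose/ufH_vertical. Qed.

Lemma ufB_ufH C : ufB C -> ufH C.
Proof.
move=> [h1 h2 h3]; case: (ltgtP (D1 C) (D2 C)) => [lt12|lt21|e].
- exact: ufH_horizontal (h2 lt12) (ltW lt12).
- exact: ufH_vertical (h1 lt21) (ltW lt21).
- have [le12 le21] : D1 C <= D2 C /\ D2 C <= D1 C by rewrite e.
  by case: (h3 e) => u; [exact: (ufH_vertical u)|exact: (ufH_horizontal u)].
Qed.

(** The rows met by one column are among all occupied rows. *)
Lemma vertical_t_le_t2 C t : vertical_fibres C t -> t <= t2 C.
Proof.
move=> vt; rewrite leNgt; apply/negP => lt2.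
have l0 := map0 C.
have := vt _ (col_J1 l0); apply/eqP; rewrite lt_eqF//.
have : \sum_(l in colset (col l0)) bb l `^ t2 C <= 1.
  have := column_sum_le (col l0) (fun j => powR_ge0 (@height _ C j) (t2 C)).
  by rewrite t2P.
have l0J : l0 \in colset (col l0) by rewrite in_colset.
apply: lt_le_trans; rewrite (bigD1 l0)//= [ltRHS](bigD1 l0)//=.
apply: ltr_leD; first by rewrite powR_lt_anti ?bb_itv.
by apply: ler_sum => l _; rewrite powR_le_anti ?bb_itv// ltW.
Qed.

Lemma E1_vertical C t : ~~ vertical_type C -> vertical_fibres C t -> E1 C = D1 C.
Proof. by move=> /negbTE vC vt; rewrite /E1 vC (S1_vertical vt) (D1_vertical vt). Qed.

(** From a^t1 b^t to b^t2 a^(D1 - t2), where D1 = t1 + t, the weight of a map is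
    multiplied by (b / a)^(t2 - t) <= 1. *)
Lemma D2_le_D1_horizontal C t : horizontal_type C -> vertical_fibres C t -> D2 C <= D1 C.
Proof.
move=> /forallP hC vt; rewrite (D1_vertical vt).
rewrite -D2_leE -(t1P C) -(sum_product (t1 C) vt); apply: ler_sum => l _.
have b0 := bb_gt0 l; have a0 := aa_gt0 l.
have tt2 : 0 <= t2 C - t by rewrite subr_ge0 vertical_t_le_t2.
have -> : t1 C + t - t2 C = t1 C - (t2 C - t) by ring.
have -> : bb l `^ t2 C = bb l `^ t * bb l `^ (t2 C - t).
  rewrite -powRD; last by apply/implyP => _; rewrite gt_eqF.
  by congr (_ `^ _); ring.
rewrite (@powRB _ (aa l)); last by apply/implyP => _; rewrite gt_eqF.
rewrite mulrACA [leRHS]mulrC ler_piMr// ?mulr_ge0 ?powR_ge0//.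
by rewrite ler_pdivrMr ?powR_gt0// mul1r ge0_ler_powR ?nnegrE// ?ltW.
Qed.

Lemma ufL_ufA C : ufL C -> ufA C.
Proof.
move=> [h1 h2 h3].
have [hC|hC] := boolP (horizontal_type C).
  have E10 := E1_ge0 (horizontal_not_vertical hC).
  have E21 : E2 C = -1 by rewrite /E2 hC.
  by split=> [_|lt12|_]; [exact: h1|exfalso; lra|left; exact: h1].
have [vC|vC] := boolP (vertical_type C).
  have E20 : 0 <= E2 C by exact: (@E1_ge0 _ (transpose C)).
  have E11 : E1 C = -1 by rewrite /E1 vC.
  by split=> [lt21|_|_]; [exfalso; lra|exact: h2|right; exact: h2].
have mC : mixed_type C by rewrite /mixed_type hC vC.
by have [u v _] := h3 mC; split=> _; [exact: u|exact: v|left; exact: u].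
Qed.

(** For horizontal type E2 = -1 says nothing about D2, so that case is treated
    separately. *)
Lemma ufB_vertical C : unif_vertical C -> E2 C <= E1 C -> ufB C.
Proof.
move=> uC E21; have [t vt] := unif_verticalP uC.
have D21 : D2 C <= D1 C.
  have [hC|hC] := boolP (horizontal_type C).
    exact: D2_le_D1_horizontal hC vt.
  have vC : ~~ vertical_type C.
    apply/negP => vC.
    have E20 : 0 <= E2 C by exact: (@E1_ge0 _ (transpose C)).
    have E11 : E1 C = -1 by rewrite /E1 vC.
    lra.
  by rewrite -(E1_vertical vC vt) (le_trans (D2_le_E2 hC)).
split=> [//|lt12|_]; last by left.
by exfalso; lra.
Qed.

Lemma ufB_transpose C : ufB (transpose C) -> ufB C.
Proof.
move=> [h1 h2 h3]; split; [exact: h2|exact: h1|].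
by move=> /esym /h3[u|u]; [right|left].
Qed.

Lemma ufB_horizontal C : unif_horizontal C -> E1 C <= E2 C -> ufB C.
Proof. by move=> uC E12; apply/ufB_transpose/ufB_vertical. Qed.

Lemma ufA_ufB C : ufA C -> ufB C.
Proof.
move=> [h1 h2 h3]; case: (ltgtP (E1 C) (E2 C)) => [lt12|lt21|e].
- exact: ufB_horizontal (h2 lt12) (ltW lt12).
- exact: ufB_vertical (h1 lt21) (ltW lt21).
- have [le12 le21] : E1 C <= E2 C /\ E2 C <= E1 C by rewrite e.
  by case: (h3 e) => u; [exact: (ufB_vertical u)|exact: (ufB_horizontal u)].
Qed.

End Implications.

(** * Existence of the attractor *)

Section Existence.
Variables (R : realType) (C : baranski_ifs R).
Implicit Types (l : 'I_(nmap C)) (X : set (R * R)).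

Definition unit_square : set (R * R) := `[0, 1] `*` `[0, 1].

Definition hutchinson X : set (R * R) := \bigcup_l (@psi R C l @` X).

Definition stage (n : nat) : set (R * R) := iter n hutchinson unit_square.

Definition limit_set : set (R * R) := \bigcap_n stage n.

Lemma unit_squareP p : unit_square p <-> (0 <= p.1 <= 1) /\ (0 <= p.2 <= 1).
Proof. by rewrite /unit_square /= !in_itv. Qed.

Lemma affine_itv (w e x : R) : 0 < w < 1 -> 0 <= e -> e + w <= 1 -> 0 <= x <= 1 ->
  0 <= w * x + e <= 1.
Proof.
move=> /andP[w0 w1] e0 ew /andP[x0 x1]; rewrite addr_ge0 ?mulr_ge0 ?(ltW w0)//=.
by apply: le_trans ew; rewrite addrC lerD2l ler_piMr// ltW.
Qed.

Lemma psi_unit_square l p : unit_square p -> unit_square (psi l p).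
Proof.
move=> /unit_squareP[p1 p2]; apply/unit_squareP; split; apply: affine_itv => //.
- exact: width_itv.
- exact: (offset_ge0 (@width_itv _ C) (col l)).
- exact: (offset_le1 (@width_itv _ C) (width_sum C) (col l)).
- exact: height_itv.
- exact: (offset_ge0 (@height_itv _ C) (row l)).
- exact: (offset_le1 (@height_itv _ C) (height_sum C) (row l)).
Qed.

Lemma hutchinson_mono X Y : X `<=` Y -> hutchinson X `<=` hutchinson Y.
Proof. by move=> XY _ [l _ [p /XY Yp <-]]; exists l => //; exists p. Qed.

Lemma stage_decr n : stage n.+1 `<=` stage n.
Proof.
elim: n => [|n IH]; last exact: hutchinson_mono.
by move=> _ [l _ [p Xp <-]]; exact: psi_unit_square.
Qed.

Lemma stage_le m n : (m <= n)%N -> stage n `<=` stage m.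
Proof.
move=> /subnK <-; elim: (n - m)%N => // k IH; rewrite addSn.
exact: subset_trans (@stage_decr _) IH.
Qed.

Lemma psi_continuous l : continuous (@psi R C l).
Proof.
move=> p; apply: (@cvg_pair _ _ _ _ (nbhs (psi l p).1) (nbhs (psi l p).2)).
- by apply: cvgD; [apply: cvgM; [exact: cvg_cst|exact: cvg_fst]|exact: cvg_cst].
- by apply: cvgD; [apply: cvgM; [exact: cvg_cst|exact: cvg_snd]|exact: cvg_cst].
Qed.

Lemma hutchinson_compact X : compact X -> compact (hutchinson X).
Proof.
move=> Xc.
have -> : hutchinson X = \big[setU/set0]_(l <- index_enum 'I_(nmap C)) (psi l @` X).
  rewrite -bigcup_seq /hutchinson; apply/seteqP; split=> p [l _ lp]; exists l => //=.
  exact: mem_index_enum.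
elim: index_enum => [|l s IH]; first by rewrite big_nil; exact: compact0.
rewrite big_cons; apply: compactU => //; apply: continuous_compact => //.
exact/continuous_subspaceT/psi_continuous.
Qed.

Lemma stage_compact n : compact (stage n).
Proof.
elim: n => [|n IH]; last exact: hutchinson_compact.
by apply: compact_setX; exact: segment_compact.
Qed.

Lemma limit_set_compact : compact limit_set.
Proof.
apply: (@subclosed_compact _ limit_set (stage 0)).
- apply: closed_bigI => n _; apply: compact_closed; last exact: stage_compact.
  exact: norm_hausdorff.
- exact: stage_compact.
- by move=> p; apply.
Qed.

Lemma psi_inj l : injective (@psi R C l).
Proof.
move=> [x y] [x' y'] [] /addIr e1 /addIr e2.
have /andP[a0 _] := @width_itv _ C (col l); have /andP[b0 _] := @height_itv _ C (row l).
have an : aa l != 0 by rewrite gt_eqF.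
have bn : bb l != 0 by rewrite gt_eqF.
by rewrite (mulfI an e1) (mulfI bn e2).
Qed.

(** A point of the limit set lies, for each n, in the image of stage n under some
    map.  The stages decrease and there are finitely many maps, so one map serves
    all n; by injectivity the preimages at the different stages agree. *)
Lemma limit_setE : limit_set = \bigcup_l (@psi R C l @` limit_set).
Proof.
apply/seteqP; split=> [p Kp|_ [l _ [p Kp <-]] n _]; last first.
  case: n => [|n]; first exact/psi_unit_square/(Kp 0%N).
  by exists l => //; exists p => //; exact: Kp.
apply: contrapT => npK.
have escape l : exists n, ~ (psi l @` stage n) p.
  apply: contrapT => h; apply: npK; exists l => //.
  have hl n : (psi l @` stage n) p by apply: contrapT => hn; apply: h; exists n.
  have [y _ yp] := hl 0%N; exists y => // n _.
  by have [y' Xy' y'p] := hl n; rewrite -(psi_inj (etrans y'p (esym yp))).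
have [N hN] := choice escape.
have [l _ [y Xy yp]] := Kp (\max_l N l).+1 I.
apply: (hN l); exists y => //; apply: stage_le Xy; exact: leq_bigmax.
Qed.

Definition fixpoint l : R * R :=
  (offset (@width _ C) (col l) / (1 - aa l), offset (@height _ C) (row l) / (1 - bb l)).

Lemma affine_fixpoint (w e : R) : 0 < w < 1 -> w * (e / (1 - w)) + e = e / (1 - w).
Proof. by move=> /andP[w0 w1]; field; rewrite subr_eq0 gt_eqF. Qed.

Lemma fixpoint_itv (w e : R) : 0 < w < 1 -> 0 <= e -> e + w <= 1 -> 0 <= e / (1 - w) <= 1.
Proof.
move=> /andP[w0 w1] e0 ew; rewrite divr_ge0 ?subr_ge0 ?(ltW w1)//=.
by rewrite ler_pdivrMr ?subr_gt0// mul1r; lra.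
Qed.

Lemma fixpoint_limit_set l : limit_set (fixpoint l).
Proof.
move=> n _; elim: n => [|n IH].
  apply/unit_squareP; split; apply: fixpoint_itv.
  - exact: width_itv.
  - exact: (offset_ge0 (@width_itv _ C) (col l)).
  - exact: (offset_le1 (@width_itv _ C) (width_sum C) (col l)).
  - exact: height_itv.
  - exact: (offset_ge0 (@height_itv _ C) (row l)).
  - exact: (offset_le1 (@height_itv _ C) (height_sum C) (row l)).
exists l => //; exists (fixpoint l) => //.
rewrite /psi /fixpoint /=; congr (_, _); apply: affine_fixpoint.
- exact: width_itv.
- exact: height_itv.
Qed.

Lemma limit_set_attractor : is_attractor C limit_set.
Proof.
split; [|exact: limit_set_compact|exact: limit_setE].
by exists (fixpoint (Ordinal (ltnW (nmap_ge2 C)))); exact: fixpoint_limit_set.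
Qed.

End Existence.

(** The fixed points lie in first-level intervals that share at most an endpoint.
    A fixed point at the right end of its interval must be 1, and no further
    interval begins there. *)
Lemma offset_fixpoint_inj (R : realType) (n : nat) (w : 'I_n -> R) (i i' : 'I_n) :
  (forall k, 0 < w k < 1) -> \sum_k w k = 1 -> i != i' ->
  offset w i / (1 - w i) != offset w i' / (1 - w i').
Proof.
move=> w01 w1; wlog ii' : i i' / (i < i')%N => [hw|_].
  move=> ne; move: (ne); rewrite neq_ltn => /orP[lt|lt]; first exact: hw.
  by rewrite eq_sym; apply: hw => //; rewrite eq_sym.
apply/negP => /eqP e.
have /andP[w0 wi1] := w01 i; have /andP[w0' wi1'] := w01 i'.
have e0 := offset_ge0 w01 i; have e0' := offset_ge0 w01 i'.
have s := offset_step w01 ii'; have e1 := offset_le1 w01 w1 i.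
have e1' := offset_le1 w01 w1 i'.
have := affine_fixpoint (offset w i) (w01 i).
have := affine_fixpoint (offset w i') (w01 i').
have /andP[] := fixpoint_itv (w01 i) e0 e1; rewrite e.
set x := _ / _ => x0 x1 xE xE'.
have : w i' * x <= w i' by rewrite ler_piMr// ltW.
have : w i * x <= w i by rewrite ler_piMr// ltW.
have : 0 <= w i' * x by rewrite mulr_ge0// ltW.
move=> h1 h2 h3.
have h4 : w i * x = w i by lra.
have : x = 1 by apply: (mulfI (_ : w i != 0)); [rewrite gt_eqF|rewrite h4 mulr1].
lra.
Qed.

Section MakeCarpet.
Variables (R : realType) (C : baranski_ifs R).
Hypothesis ab : exists l : 'I_(nmap C), aa l != bb l.
Hypothesis cols : exists l l' : 'I_(nmap C), col l != col l'.
Hypothesis rows : exists l l' : 'I_(nmap C), row l != row l'.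

Lemma limit_set_not_vertical : ~ exists c : R, limit_set C `<=` [set p | p.1 = c].
Proof.
move=> [c h]; have [l [l' ll']] := cols.
have := offset_fixpoint_inj (@width_itv _ C) (@width_sum _ C) ll'.
have := h _ (fixpoint_limit_set l); have := h _ (fixpoint_limit_set l').
by rewrite /fixpoint /aa /= => -> ->; rewrite eqxx.
Qed.

Lemma limit_set_not_horizontal : ~ exists c : R, limit_set C `<=` [set p | p.2 = c].
Proof.
move=> [c h]; have [l [l' ll']] := rows.
have := offset_fixpoint_inj (@height_itv _ C) (@height_sum _ C) ll'.
have := h _ (fixpoint_limit_set l); have := h _ (fixpoint_limit_set l').
by rewrite /fixpoint /bb /= => -> ->; rewrite eqxx.
Qed.

Definition make_carpet : carpet R :=
  Carpet (limit_set_attractor C) ab limit_set_not_vertical limit_set_not_horizontal.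

End MakeCarpet.

(** * Carpets with at most one rectangle in each column *)

Section InjectiveColumns.
Variables (R : realType) (C : carpet R).
Hypothesis col_inj : injective (@col _ C).

Lemma sum_column_inj i (F : 'I_(nmap C) -> R) (l : 'I_(nmap C)) : col l = i ->
  \sum_(m in colset i) F m = F l.
Proof.
move=> <-; rewrite (big_pred1 l)// => m.
by rewrite in_colset (inj_eq col_inj).
Qed.

Lemma column_inj_fibres : vertical_fibres C 0.
Proof. by move=> i /J1P[l li]; rewrite (sum_column_inj _ li) powRr0. Qed.

Lemma sum_J1_inj (F : 'I_(ncol C) -> R) :
  \sum_(i in J1 C) F i = \sum_(l < nmap C) F (col l).
Proof.
rewrite sum_columns; apply: eq_bigr => i /J1P[l li].
by rewrite (sum_column_inj (F \o @col _ C) li)/= li.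
Qed.

End InjectiveColumns.

Lemma D2_horizontal (R : realType) (C : carpet R) t :
  vertical_fibres (transpose C) t -> D2 C = t2 C + t.
Proof. exact: (@D1_vertical _ (transpose C)). Qed.

Lemma horizontal_dim_ge (R : realType) (C : carpet R) t :
  vertical_fibres (transpose C) t -> ((t2 C + t)%:E <= hausdorff_dim (attr C))%E.
Proof.
by rewrite -(hausdorff_dim_swap (attr C)); exact: (@vertical_dim_ge _ (transpose C)).
Qed.

Section InjectiveRows.
Variables (R : realType) (C : carpet R).
Hypothesis row_inj : injective (@row _ C).

Lemma sum_J2_inj (F : 'I_(nrow C) -> R) :
  \sum_(j in J2 C) F j = \sum_(l < nmap C) F (row l).
Proof. exact: (@sum_J1_inj _ (transpose C) row_inj). Qed.

Lemma row_inj_fibres : vertical_fibres (transpose C) 0.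
Proof. exact: (@column_inj_fibres _ (transpose C) row_inj). Qed.

Lemma row_inj_unif : unif_horizontal C.
Proof. by exists 0; split=> //; exact: row_inj_fibres. Qed.

End InjectiveRows.

Lemma F1_vertical (R : realType) (C : carpet R) t :
  ~~ vertical_type C -> vertical_fibres C t -> F1 C = t1 C + t.
Proof. by move=> /negbTE vC vt; rewrite /F1 vC (range_S1_vertical vt) inf1. Qed.

(** * A diagonal carpet *)

(** Both kinds of fibres are single rectangles, hence uniform with exponent 0, and
    every clause of u.f.A holds.  But F1 = t1 = 1, as the widths have sum 1, while
    F2 = t2 differs from 1, as the heights in use have sum 7/8. *)
Section Example1.
Variable R : realType.

Definition width1 (i : 'I_2) : R := 2^-1.
Definition height1 (j : 'I_3) : R := nth 0 [:: 3 / 4; 8^-1; 8^-1] j.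
Definition pos1 (l : 'I_2) : 'I_2 * 'I_3 := (l, widen_ord (isT : (2 <= 3)%N) l).

Lemma width1_itv i : 0 < width1 i < 1.
Proof. by apply/andP; rewrite /width1; split; lra. Qed.

Lemma height1_itv j : 0 < height1 j < 1.
Proof. by case: j => -[|[|[|]]]//= ?; rewrite /height1/=; apply/andP; split; lra. Qed.

Lemma width1_sum : \sum_i width1 i = 1.
Proof. by rewrite !big_ord_recl big_ord0 /width1; lra. Qed.

Lemma height1_sum : \sum_j height1 j = 1.
Proof. by rewrite !big_ord_recl big_ord0 /height1/=; lra. Qed.

Lemma pos1_inj : injective pos1.
Proof. by move=> l l' []. Qed.

Definition ifs1 : baranski_ifs R :=
  BaranskiIFS (isT : (2 <= 2)%N) (isT : (2 <= 3)%N) (isT : (2 <= 2)%N) (isT : (2 <= 2 * 3)%N)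
    width1_itv height1_itv width1_sum height1_sum pos1_inj.

Definition fst1 : 'I_2 := ord0.
Definition snd1 : 'I_2 := ord_max.

Lemma ifs1_neq : exists l : 'I_(nmap ifs1), aa l != bb l.
Proof. by exists fst1; rewrite /aa /bb/= /width1 /height1/=; apply/negP => /eqP; lra. Qed.

Lemma ifs1_cols : exists l l' : 'I_(nmap ifs1), col l != col l'.
Proof. by exists fst1, snd1. Qed.

Lemma ifs1_rows : exists l l' : 'I_(nmap ifs1), row l != row l'.
Proof. by exists fst1, snd1. Qed.

Definition carpet1 : carpet R := make_carpet ifs1_neq ifs1_cols ifs1_rows.

Lemma carpet1_col_inj : injective (@col _ carpet1).
Proof. by []. Qed.

Lemma carpet1_row_inj : injective (@row _ carpet1).
Proof. by move=> l l' [/val_inj]. Qed.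

Lemma carpet1_not_ufL : ~ (ufA carpet1 -> ufL carpet1).
Proof.
have u : unif_vertical carpet1.
  by exists 0; split=> //; exact: column_inj_fibres carpet1_col_inj.
have v : unif_horizontal carpet1 := row_inj_unif carpet1_row_inj.
have hC : ~~ horizontal_type carpet1.
  apply/negP => /forallP /(_ fst1); rewrite /aa /bb/= /width1 /height1/=; lra.
have vC : ~~ vertical_type carpet1.
  apply/negP => /forallP /(_ snd1); rewrite /aa /bb/= /width1 /height1/=; lra.
have F1E := F1_vertical vC (column_inj_fibres carpet1_col_inj).
have F2E : F2 carpet1 = t2 carpet1 + 0.
  exact: (@F1_vertical _ (transpose carpet1) 0 hC (row_inj_fibres carpet1_row_inj)).
have t1E : t1 carpet1 = 1.
  apply: t1E; rewrite (sum_J1_inj carpet1_col_inj).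
  by rewrite !big_ord_recl big_ord0 /= /width1 !powRr1; lra.
move=> h.
have /h[_ _] : ufA carpet1 by split=> _; [exact: u|exact: v|left; exact: u].
case; first by rewrite /mixed_type hC vC.
move=> _ _; rewrite F1E F2E !addr0 t1E => t2E.
have := t2P carpet1; rewrite -t2E (sum_J2_inj carpet1_row_inj).
by rewrite !big_ord_recl big_ord0 /= /height1/= !powRr1; lra.
Qed.

End Example1.

Lemma powR_root (R : realType) (x : R) (n : nat) : 0 <= x ->
  (x ^+ n.+1) `^ n.+1%:R^-1 = x.
Proof. by move=> x0; rewrite -powR_mulrn// -powRrM divff ?pnatr_eq0// powRr1. Qed.

Lemma J2P (R : realType) (C : carpet R) j : reflect (exists l, @row _ C l = j) (j \in J2 C).
Proof. exact: (@J1P _ (transpose C) j). Qed.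

Lemma t2E (R : realType) (C : carpet R) t : \sum_(j in J2 C) height j `^ t = 1 -> t2 C = t.
Proof. exact: (@t1E _ (transpose C)). Qed.

(** * A carpet with one rectangle in each column *)

(** Here t = 0 and E1 = D1 = t1 = 1, and the heights in use are squares with roots of
    sum 1, so t2 = 1/2.  The row with two rectangles of width 1/3 has a fibre exponent
    above 1/2, which makes E2 > 1; but that row is low, and its influence on D2 is so
    small that D2 <= 1. *)
Section Example2.
Variable R : realType.

Definition width2 (i : 'I_3) : R := 3^-1.
Definition height2 (j : 'I_3) : R := nth 0 [:: 9^-1; 4 / 9; 4 / 9] j.

Lemma half_lt3 (l : 'I_3) : (l./2 < 3)%N.
Proof. by case: l => -[|[|[|]]]. Qed.

Definition pos2 (l : 'I_3) : 'I_3 * 'I_3 := (l, Ordinal (half_lt3 l)).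

Lemma width2_itv i : 0 < width2 i < 1.
Proof. by apply/andP; rewrite /width2; split; lra. Qed.

Lemma height2_itv j : 0 < height2 j < 1.
Proof. by case: j => -[|[|[|]]]//= ?; rewrite /height2/=; apply/andP; split; lra. Qed.

Lemma width2_sum : \sum_i width2 i = 1.
Proof. by rewrite !big_ord_recl big_ord0 /width2; lra. Qed.

Lemma height2_sum : \sum_j height2 j = 1.
Proof. by rewrite !big_ord_recl big_ord0 /height2/=; lra. Qed.

Lemma pos2_inj : injective pos2.
Proof. by move=> l l' []. Qed.

Definition ifs2 : baranski_ifs R :=
  BaranskiIFS (isT : (2 <= 3)%N) (isT : (2 <= 3)%N) (isT : (2 <= 3)%N) (isT : (3 <= 3 * 3)%N)
    width2_itv height2_itv width2_sum height2_sum pos2_inj.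

Definition fst2 : 'I_3 := ord0.
Definition last2 : 'I_3 := ord_max.

Lemma ifs2_neq : exists l : 'I_(nmap ifs2), aa l != bb l.
Proof. by exists fst2; rewrite /aa /bb/= /width2 /height2/=; apply/negP => /eqP; lra. Qed.

Lemma ifs2_cols : exists l l' : 'I_(nmap ifs2), col l != col l'.
Proof. by exists fst2, last2. Qed.

Lemma ifs2_rows : exists l l' : 'I_(nmap ifs2), row l != row l'.
Proof. by exists fst2, last2. Qed.

Definition carpet2 : carpet R := make_carpet ifs2_neq ifs2_cols ifs2_rows.

Lemma carpet2_col_inj : injective (@col _ carpet2).
Proof. by []. Qed.

Lemma carpet2_sum_J2 (F : 'I_3 -> R) :
  \sum_(j in J2 carpet2) F j = F ord0 + F (lift ord0 ord0).
Proof.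
have j0 : ord0 \in J2 carpet2 by apply/J2P; exists fst2; apply: val_inj.
have j1 : lift ord0 ord0 \in J2 carpet2 by apply/J2P; exists last2; apply: val_inj.
have j2 : lift ord0 (lift ord0 ord0) \in J2 carpet2 = false.
  by apply/J2P => -[[[|[|[|]]]]//= h /(congr1 val)].
by rewrite big_mkcond/= !big_ord_recl big_ord0 j0 j1 j2 !addr0.
Qed.

Lemma carpet2_sum_row0 (F : 'I_3 -> R) :
  \sum_(m in @rowset _ carpet2 (row (C := carpet2) fst2)) F m = F ord0 + F (lift ord0 ord0).
Proof.
by rewrite big_mkcond/= !big_ord_recl big_ord0 !inE/= !addr0.
Qed.

Lemma carpet2_sum_row1 (F : 'I_3 -> R) :
  \sum_(m in @rowset _ carpet2 (row (C := carpet2) last2)) F m = F last2.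
Proof.
rewrite big_mkcond/= !big_ord_recl big_ord0 !inE/= !add0r addr0.
by congr F; apply: val_inj.
Qed.

Lemma carpet2_not_ufA : ~ (ufB carpet2 -> ufA carpet2).
Proof.
have ninth : (9^-1 : R) `^ 2^-1 = 3^-1.
  have -> : (9^-1 : R) = 3^-1 ^+ 2 by field.
  by rewrite powR_root.
have fourninth : (4 / 9 : R) `^ 2^-1 = 2 / 3.
  have -> : (4 / 9 : R) = (2 / 3) ^+ 2 by field.
  by rewrite powR_root//; lra.
set s := (3^-1 : R) `^ 2^-1.
have s0 : 0 <= s by exact: powR_ge0.
have s2 : s * s = 3^-1.
  rewrite -powRD; last by apply/implyP => _; rewrite gt_eqF.
  have -> : (2^-1 + 2^-1 : R) = 1 by lra.
  by rewrite powRr1.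
have s_gt : 2^-1 < s.
  rewrite ltNge; apply/negP => h.
  by have := ler_pM s0 s0 h h; rewrite s2; lra.
have s_lt : s <= 3 / 4.
  rewrite leNgt; apply/negP => h.
  have h0 : (0 : R) <= 3 / 4 by lra.
  by have := ler_pM h0 h0 (ltW h) (ltW h); rewrite s2; lra.
have vt := column_inj_fibres carpet2_col_inj.
have u : unif_vertical carpet2 by exists 0.
have hC : ~~ horizontal_type carpet2.
  apply/negP => /forallP /(_ last2); rewrite /aa /bb/= /width2 /height2/=; lra.
have vC : ~~ vertical_type carpet2.
  apply/negP => /forallP /(_ fst2); rewrite /aa /bb/= /width2 /height2/=; lra.
have t1e : t1 carpet2 = 1.
  apply: t1E; rewrite (sum_J1_inj carpet2_col_inj).
  by rewrite !big_ord_recl big_ord0 /= /width2 !powRr1; lra.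
have t2e : t2 carpet2 = 2^-1.
  apply: t2E; rewrite carpet2_sum_J2/= /height2/= ninth fourninth; lra.
have D1e : D1 carpet2 = 1 by rewrite (D1_vertical vt) t1e addr0.
have D2le : D2 carpet2 <= 1.
  rewrite -D2_leE t2e.
  have -> : (1 - 2^-1 : R) = 2^-1 by lra.
  rewrite !big_ord_recl big_ord0 /aa /bb/= /width2 /height2/= ninth fourninth -/s; lra.
have S2gt : 2^-1 < S2 (C := carpet2) fst2.
  have S2e : \sum_(m in @rowset _ carpet2 (row (C := carpet2) fst2))
      aa (C := carpet2) m `^ S2 (C := carpet2) fst2 = 1.
    exact: (@S1P _ (transpose carpet2) fst2).
  rewrite ltNge; apply/negP => h; move: S2e; rewrite carpet2_sum_row0 /aa/= /width2.
  have := powR_le_anti (width2_itv fst2) h; rewrite /width2 -/s; lra.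
have E1e : E1 carpet2 = 1 by rewrite (E1_vertical vC vt).
have E2gt : 1 < E2 carpet2.
  rewrite /E2 (negbTE hC) t2e.
  have : S2 (C := carpet2) fst2 <= sup (range (@S2 _ carpet2)).
    exact: (@S1_le_sup _ (transpose carpet2) fst2).
  lra.
move=> h; have /h[_ + _] : ufB carpet2.
  split=> [_|lt12|_]; [exact: u|exfalso; lra|left; exact: u].
rewrite E1e => /(_ E2gt)[t [_ ht]].
have := ht _ (@row_J2 _ carpet2 last2); rewrite carpet2_sum_row1.
have := ht _ (@row_J2 _ carpet2 fst2); rewrite carpet2_sum_row0.
rewrite /aa/= /width2; lra.
Qed.

End Example2.

(** * A carpet with one rectangle in each row *)

Section ConditionalEntropy.
Variables (R : realType) (C : carpet R) (q kappa : 'I_(nmap C) -> R).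
Hypothesis q_simplex : simplex q.
Hypothesis kappa_gt0 : forall l, 0 < kappa l.
Hypothesis kappa_sum : forall i, i \in J1 C -> \sum_(l in colset i) kappa l <= 1.

(** Gibbs' inequality in each column, against the measure that has the same mass and
    is distributed according to kappa. *)
Lemma conditional_entropy_le : \sum_l q l * ln (kappa l) <= QQ q - RR q.
Proof.
have [q0 _] := q_simplex.
rewrite lerBrDr /QQ [leRHS]sum_columns sum_columns RR_J1 -big_split/=.
apply: ler_sum => i iJ; have R0 := Rcol_ge0 q_simplex i.
move: (R0); rewrite le_eqVlt => /predU1P[/esym Ri0|Rgt0].
  have qi0 l : l \in colset i -> q l = 0.
    by apply: (psumr_eq0P _ Ri0) => l' _; exact: q0.
  rewrite Ri0 mul0r addr0 !big1// => l li; by rewrite qi0// mul0r.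
have := @gibbs _ _ (mem (colset i)) q (fun l => Rcol q i * kappa l).
move=> /(_ (fun l _ => q0 l) (fun l _ => mulr_gt0 Rgt0 (kappa_gt0 l))) => h.
have {}h := h _; apply: le_trans (h _); last first.
  by rewrite -mulr_sumr ler_piMr// kappa_sum.
rewrite /Rcol mulr_suml -/(Rcol q i) -big_split/=; apply: ler_sum => l _.
by rewrite lnM ?posrE// -mulrDr addrC.
Qed.

End ConditionalEntropy.

(** The estimate of g on [simplex1] for the carpet below, with u = ln 2, v = ln 3,
    x the weight of the first column, A = - RA, B = - SB, h the entropy of the
    columns and E the conditional entropy.  The three bounds on h are the cross
    entropies relative to (1/2, 1/2), (3/4, 1/4) and (8/9, 1/9), that is, tangents to
    the entropy function; near each of these values of x the corresponding one is
    sharp enough.  The condition A <= B excludes x < 0.28, and after dividing by u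
    the constants 19/12 and 27/17 leave quadratic inequalities in x alone. *)
Lemma third_example_bound (R : realType) (u v x h E : R) :
  0 < u -> 19 / 12 * u <= v -> v <= 27 / 17 * u -> 0 <= x <= 1 ->
  let A := 5 * (x * (2 * v - 3 * u) + (1 - x) * (2 * v)) in
  let B := 4 * (x * (2 * v) + (1 - x) * (3 * v - 2 * u)) in
  A <= B -> h <= u -> h <= x * (2 * u - v) + (1 - x) * (2 * u) ->
  h <= x * (2 * v - 3 * u) + (1 - x) * (2 * v) -> E <= (1 - x) * (u + v) ->
  h / A + E / B < 4^-1.
Proof.
move=> u0 vlo vhi /andP[x0 x1] A B AB h1 h2 h3 hE.
pose A0 := 5 / 6 * (19 - 18 * x); pose B0 := 11 + 5 / 3 * x.
pose E0 := 44 / 17 * (1 - x).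
have A00 : 0 < A0 by rewrite /A0; lra.
have B00 : 0 < B0 by rewrite /B0; lra.
have E00 : 0 <= E0 by rewrite /E0; lra.
have y0 : 0 <= 1 - x by rewrite subr_ge0.
have xv : x * (19 / 12 * u) <= x * v by rewrite ler_wpM2l.
have yv : (1 - x) * (19 / 12 * u) <= (1 - x) * v by rewrite ler_wpM2l.
have xv' : x * v <= x * (27 / 17 * u) by rewrite ler_wpM2l.
have yv' : (1 - x) * v <= (1 - x) * (27 / 17 * u) by rewrite ler_wpM2l.
have AA : u * A0 <= A by rewrite /A /A0; lra.
have BB : u * B0 <= B by rewrite /B /B0; lra.
have EE : E <= u * E0 by rewrite /E0; lra.
have x_ge : 28 / 100 <= x.
  rewrite leNgt; apply/negP => xlt.
  have : x * (23 * u - 4 * v) <= 28 / 100 * (23 * u - 4 * v).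
    by apply: ler_wpM2r; lra.
  by move: AB; rewrite /A /B; lra.
have key h0 : 0 <= h0 -> h <= u * h0 -> 4 * (h0 * B0 + E0 * A0) < A0 * B0 ->
    h / A + E / B < 4^-1.
  move=> h00 hh main.
  have AP : 0 < A by apply: lt_le_trans AA; rewrite mulr_gt0.
  have BP : 0 < B by apply: lt_le_trans BB; rewrite mulr_gt0.
  have le1 : h / A <= h0 / A0.
    rewrite ler_pdivrMr// mulrAC ler_pdivlMr//.
    apply: (@le_trans _ _ (u * h0 * A0)); first by rewrite ler_wpM2r// ltW.
    by rewrite mulrAC mulrC ler_wpM2l.
  have le2 : E / B <= E0 / B0.
    rewrite ler_pdivrMr// mulrAC ler_pdivlMr//.
    apply: (@le_trans _ _ (u * E0 * B0)); first by rewrite ler_wpM2r// ltW.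
    by rewrite mulrAC mulrC ler_wpM2l.
  apply: (le_lt_trans (lerD le1 le2)).
  rewrite addf_div ?gt_eqF// ltr_pdivrMr ?mulr_gt0//; lra.
have [xa|xa] := lerP x (65 / 100).
  apply: (key 1); rewrite ?mulr1//.
  by rewrite /A0 /B0 /E0; nra.
have [xb|xb] := lerP x (82 / 100).
  apply: (key (2 - 19 / 12 * x)); [lra|lra|].
  by rewrite /A0 /B0 /E0; nra.
apply: (key (54 / 17 - 3 * x)); [lra|lra|].
by rewrite /A0 /B0 /E0; nra.
Qed.

Lemma ln3_bounds (R : realType) :
  19 / 12 * ln 2 <= ln 3 :> R /\ ln 3 <= 27 / 17 * ln 2 :> R.
Proof.
have l2 (n : nat) : ln ((2 : R) ^+ n) = n%:R * ln 2 by rewrite lnXn// mulr_natl.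
have l3 (n : nat) : ln ((3 : R) ^+ n) = n%:R * ln 3 by rewrite lnXn// mulr_natl.
split.
  have : ln ((2 : R) ^+ 19) <= ln ((3 : R) ^+ 12).
    by rewrite ler_ln ?posrE ?exprn_gt0//; lra.
  by rewrite l2 l3; lra.
have : ln ((3 : R) ^+ 17) <= ln ((2 : R) ^+ 27).
  by rewrite ler_ln ?posrE ?exprn_gt0//; lra.
by rewrite l2 l3; lra.
Qed.

(** All horizontal fibres are single rectangles, so dim K >= t2 = D2.  The heights are
    fourth powers and the widths fifth powers of numbers with sum 1, whence t2 = 1/4
    and t1 = 1/5, and these numbers have no prime factors besides 2 and 3.  The first
    column has one rectangle and the second has six, so the vertical fibres are not
    uniform; the parameters are chosen such that D1 > 1/4 although g < 1/4 on all of
    [simplex1].  A third column and an eighth row fill up the unit square. *)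
Section Example3.
Variable R : realType.

Definition width3 (i : 'I_3) : R :=
  nth 0 [:: (8 / 9) ^+ 5; 9^-1 ^+ 5; 1 - (8 / 9) ^+ 5 - 9^-1 ^+ 5] i.
Definition height3 (j : 'I_8) : R :=
  if j == 0%N :> nat then 9^-1 ^+ 4 else
  if (j < 7)%N then (4 / 27) ^+ 4 else 1 - 9^-1 ^+ 4 - (4 / 27) ^+ 4 *+ 6.

Lemma nat_of_bool_lt3 (c : bool) : (c < 3)%N.
Proof. by case: c. Qed.

Definition pos3 (l : 'I_7) : 'I_3 * 'I_8 :=
  (Ordinal (nat_of_bool_lt3 (l != 0%N :> nat)), widen_ord (isT : (7 <= 8)%N) l).

Lemma width3_itv i : 0 < width3 i < 1.
Proof.
by case: i => -[|[|[|]]]//= ?; rewrite /width3/=; apply/andP; split; lra.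
Qed.

Lemma height3_itv j : 0 < height3 j < 1.
Proof.
rewrite /height3; case: ifP => _; last case: ifP => _.
- by apply/andP; split; lra.
- by apply/andP; split; lra.
- by apply/andP; split; lra.
Qed.

Lemma width3_sum : \sum_i width3 i = 1.
Proof. by rewrite !big_ord_recl big_ord0 /width3/=; lra. Qed.

Lemma height3_sum : \sum_j height3 j = 1.
Proof. by rewrite !big_ord_recl big_ord0 /height3/=; lra. Qed.

Lemma pos3_inj : injective pos3.
Proof. by move=> l l' [_ /val_inj]. Qed.

Definition ifs3 : baranski_ifs R :=
  BaranskiIFS (isT : (2 <= 3)%N) (isT : (2 <= 8)%N) (isT : (2 <= 7)%N) (isT : (7 <= 3 * 8)%N)
    width3_itv height3_itv width3_sum height3_sum pos3_inj.

Definition fst3 : 'I_7 := ord0.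
Definition snd3 : 'I_7 := lift ord0 ord0.

Lemma aa3E (l : 'I_7) :
  @aa R ifs3 l = if l == 0%N :> nat then (8 / 9) ^+ 5 else 9^-1 ^+ 5.
Proof. by rewrite /aa/= /width3/=; case: eqP. Qed.

Lemma bb3E (l : 'I_7) :
  @bb R ifs3 l = if l == 0%N :> nat then 9^-1 ^+ 4 else (4 / 27) ^+ 4.
Proof. by rewrite /bb/= /height3/= ltn_ord. Qed.

Lemma ifs3_neq : exists l : 'I_(nmap ifs3), aa l != bb l.
Proof. by exists fst3; rewrite aa3E bb3E/=; apply/negP => /eqP; lra. Qed.

Lemma ifs3_cols : exists l l' : 'I_(nmap ifs3), col l != col l'.
Proof. by exists fst3, snd3. Qed.

Lemma ifs3_rows : exists l l' : 'I_(nmap ifs3), row l != row l'.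
Proof. by exists fst3, snd3. Qed.

Definition carpet3 : carpet R := make_carpet ifs3_neq ifs3_cols ifs3_rows.

Lemma carpet3_row_inj : injective (@row _ carpet3).
Proof. by move=> l l' [/val_inj]. Qed.

Lemma carpet3_sum_J1 (F : 'I_3 -> R) :
  \sum_(i in J1 carpet3) F i = F ord0 + F (lift ord0 ord0).
Proof.
have j0 : ord0 \in J1 carpet3 by apply/J1P; exists fst3; apply: val_inj.
have j1 : lift ord0 ord0 \in J1 carpet3 by apply/J1P; exists snd3; apply: val_inj.
have j2 : lift ord0 (lift ord0 ord0) \in J1 carpet3 = false.
  by apply/J1P => -[l /(congr1 val)/=]; case: eqP.
by rewrite big_mkcond/= !big_ord_recl big_ord0 j0 j1 j2 !addr0.
Qed.

Lemma carpet3_sum_colset (F : 'I_7 -> R) (i : 'I_3) :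
  \sum_(m in @colset _ carpet3 i) F m =
  \sum_(m < 7) if (m != 0%N :> nat) == i :> nat then F m else 0.
Proof.
by rewrite big_mkcond/=; apply: eq_bigr => m _; rewrite inE.
Qed.

Lemma two_class_sum (q : 'I_7 -> R) (c d : R) : \sum_l q l = 1 ->
  \sum_(l < 7) q l * (if l == 0%N :> nat then c else d) =
  q fst3 * c + (1 - q fst3) * d.
Proof.
move=> <-; rewrite big_ord_recl [X in (X - _) * d]big_ord_recl/= addrAC subrr add0r.
by rewrite mulr_suml.
Qed.

Let u : R := ln 2.
Let v : R := ln 3.

Let ln_ninth : ln (9^-1 : R) = - (2 * v).
Proof.
have -> : (9^-1 : R) = (3 ^+ 2)^-1 by rewrite -natrX.
by rewrite lnV ?posrE// lnXn// mulr_natl.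
Qed.

Let ln_eightninth : ln (8 / 9 : R) = 3 * u - 2 * v.
Proof.
rewrite ln_div ?posrE//.
have -> : (8 : R) = 2 ^+ 3 by rewrite -natrX.
have -> : (9 : R) = 3 ^+ 2 by rewrite -natrX.
by rewrite !lnXn// !mulr_natl.
Qed.

Let ln_fourtwentyseventh : ln (4 / 27 : R) = 2 * u - 3 * v.
Proof.
rewrite ln_div ?posrE//.
have -> : (4 : R) = 2 ^+ 2 by rewrite -natrX.
have -> : (27 : R) = 3 ^+ 3 by rewrite -natrX.
by rewrite !lnXn// !mulr_natl.
Qed.

Lemma carpet3_g_lt (q : 'I_7 -> R) :
  simplex1 (C := carpet3) q -> g (C := carpet3) q < 4^-1.
Proof.
move=> [qs BA]; have [q0 q1] := qs.
rewrite /= in BA; rewrite /g BA.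
set x := q fst3.
have x01 : 0 <= x <= 1.
  rewrite q0/= -q1 [leRHS]big_ord_recl/= lerDl sumr_ge0// => l _; exact: q0.
have RAE : RA (C := carpet3) q =
    - (5 * (x * (2 * v - 3 * u) + (1 - x) * (2 * v))).
  transitivity (\sum_(l < 7) q l * (if l == 0%N :> nat then 5 * (3 * u - 2 * v)
      else - (10 * v))).
    apply: eq_bigr => l _; rewrite aa3E; congr (_ * _); case: ifP => _.
      by rewrite lnXn ?ln_eightninth ?mulr_natl//; lra.
    by rewrite lnXn ?ln_ninth//; lra.
  by rewrite two_class_sum// -/x; ring.
have SBE : SB (C := carpet3) q =
    - (4 * (x * (2 * v) + (1 - x) * (3 * v - 2 * u))).
  transitivity (\sum_(l < 7) q l * (if l == 0%N :> nat then - (8 * v)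
      else 4 * (2 * u - 3 * v))).
    apply: eq_bigr => l _; rewrite bb3E; congr (_ * _); case: ifP => _.
      by rewrite lnXn ?ln_ninth//; lra.
    by rewrite lnXn ?ln_fourtwentyseventh ?mulr_natl//; lra.
  by rewrite two_class_sum// -/x; ring.
have RRle (r : R) : 0 < r < 1 ->
    - RR (C := carpet3) q <= - (x * ln r + (1 - x) * ln (1 - r)).
  move=> /andP[r0 r1]; rewrite lerN2.
  pose w (i : 'I_3) := if i == 0%N :> nat then r else 1 - r.
  have := @RR_ge _ carpet3 q qs w; rewrite carpet3_sum_J1 /w/= => h.
  apply: le_trans (h _ _) => [|i _|]; last by lra.
    rewrite -two_class_sum// le_eqVlt; apply/orP; left; apply/eqP.
    by apply: eq_bigr => l _ /=; congr (_ * _); case: (nat_of_ord l).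
  by case: ifP => _; lra.
have Ele : RR (C := carpet3) q - QQ (C := carpet3) q <= (1 - x) * (u + v).
  pose kappa (l : 'I_7) : R := if l == 0%N :> nat then 1 else 6^-1.
  have := @conditional_entropy_le _ carpet3 q kappa qs.
  have -> : \sum_l q l * ln (kappa l) = - ((1 - x) * (u + v)).
    transitivity (\sum_(l < 7) q l * (if l == 0%N :> nat then 0 else - (u + v))).
      apply: eq_bigr => l _; rewrite /kappa; congr (_ * _); case: ifP => _.
        exact: ln1.
      rewrite lnV ?posrE//; congr (- _); rewrite /u /v -lnM ?posrE//.
      by rewrite -natrM.
    by rewrite two_class_sum// -/x; ring.
  move=> h; suff : - ((1 - x) * (u + v)) <= QQ (C := carpet3) q - RR (C := carpet3) q by lra.
  apply: h => [l|i _]; first by rewrite /kappa; case: ifP.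
  rewrite carpet3_sum_colset !big_ord_recl big_ord0 /kappa/=.
  by case: i => -[|[|[|]]]//= ?; lra.
have [vlo vhi] : 19 / 12 * u <= v /\ v <= 27 / 17 * u := ln3_bounds R.
have u0 : 0 < u by rewrite ln_gt0// ltr1n.
have h1 := RRle 2^-1; have h2 := RRle (3 / 4); have h3 := RRle (8 / 9).
have eqg : RR (C := carpet3) q / RA (C := carpet3) q +
    (QQ (C := carpet3) q - RR (C := carpet3) q) / SB (C := carpet3) q =
  - RR (C := carpet3) q / - RA (C := carpet3) q +
    (RR (C := carpet3) q - QQ (C := carpet3) q) / - SB (C := carpet3) q.
  by rewrite !invrN mulrNN mulrN -mulNr opprB.
rewrite eqg RAE SBE !opprK; apply: (third_example_bound u0 vlo vhi x01) => //.
- by move: BA; rewrite RAE SBE; lra.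
- apply: le_trans (h1 _) _; first by lra.
  have -> : 1 - 2^-1 = 2^-1 :> R by lra.
  by rewrite lnV ?posrE// -/u; lra.
- apply: le_trans (h2 _) _; first by lra.
  have -> : 1 - 3 / 4 = 4^-1 :> R by lra.
  rewrite ln_div ?posrE// lnV ?posrE//.
  have -> : (4 : R) = 2 ^+ 2 by rewrite -natrX.
  by rewrite lnXn// -/u -/v; lra.
- apply: le_trans (h3 _) _; first by lra.
  have -> : 1 - 8 / 9 = 9^-1 :> R by lra.
  by rewrite ln_ninth ln_eightninth; lra.
Qed.

Lemma carpet3_not_ufB : ~ (ufH carpet3 -> ufB carpet3).
Proof.
have ht := row_inj_fibres carpet3_row_inj.
have hu := row_inj_unif carpet3_row_inj.
have t2e : t2 carpet3 = 4^-1.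
  apply: t2E; rewrite (sum_J2_inj carpet3_row_inj).
  transitivity (\sum_(l < 7) (if l == 0%N :> nat then 9^-1 else 4 / 27) : R).
    apply: eq_bigr => l _; rewrite -/(bb (C := carpet3) l) bb3E.
    by case: ifP => _; rewrite powR_root//; lra.
  by rewrite !big_ord_recl big_ord0/=; lra.
have D2e : D2 carpet3 = 4^-1.
  by rewrite (D2_horizontal ht) t2e addr0.
have t1e : t1 carpet3 = 5^-1.
  apply: t1E; rewrite carpet3_sum_J1 /= /width3/= !powR_root//; lra.
have ge_dim : ((4^-1)%:E <= hausdorff_dim (attr carpet3))%E.
  by have := horizontal_dim_ge ht; rewrite t2e addr0.
have D1gt : 4^-1 < D1 carpet3.
  rewrite ltNge -D1_leE -ltNge t1e.
  have -> : (4^-1 - 5^-1 : R) = 4^-1 * 5^-1 by lra.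
  (* 0.64 ^ 5 < 1 / 9 and 0.68 ^ 5 < 4 / 27. *)
  have lo1 : 64 / 100 <= (9^-1 : R) `^ 5^-1.
    rewrite -[leLHS](@powR_root _ _ 4); last by lra.
    by rewrite ge0_ler_powR ?nnegrE; lra.
  have lo2 : 68 / 100 <= (4 / 27 : R) `^ 5^-1.
    rewrite -[leLHS](@powR_root _ _ 4); last by lra.
    by rewrite ge0_ler_powR ?nnegrE; lra.
  have termE (l : 'I_7) : aa (C := carpet3) l `^ 5^-1 *
      bb (C := carpet3) l `^ (4^-1 * 5^-1) =
      if l == 0%N :> nat then 8 / 9 * (9^-1 : R) `^ 5^-1
      else 9^-1 * (4 / 27 : R) `^ 5^-1.
    by rewrite aa3E bb3E powRrM; case: ifP => _; rewrite !powR_root//; lra.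
  apply: (@lt_le_trans _ _ (\sum_(l < 7) (if l == 0%N :> nat
    then 8 / 9 * (9^-1 : R) `^ 5^-1 else 9^-1 * (4 / 27 : R) `^ 5^-1))).
    by rewrite !big_ord_recl big_ord0/=; lra.
  by apply: ler_sum => l _; rewrite termE.
move=> h; have /h[nu _ _] : ufH carpet3.
  split=> [[q q1 gq]|_]; last exact: hu.
  by exfalso; move: ge_dim; rewrite -gq lee_fin leNgt carpet3_g_lt.
have [|t [_ vt]] := nu; first by rewrite D2e.
have := vt _ (@col_J1 _ carpet3 fst3); have := vt _ (@col_J1 _ carpet3 snd3).
rewrite !carpet3_sum_colset !big_ord_recl !big_ord0/= !addr0 !add0r /row/= /height3/=.
set z := ((4 / 27) ^+ 4) `^ t => z6.
move=> /eqP; rewrite powR_eq1 => /or3P[/eqP|xneg|/eqP t0].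
- lra.
- lra.
by move: z6; rewrite /z t0 !powRr0; lra.
Qed.

End Example3.

Theorem proposition1p5 (R : realType) :
  [/\ forall C : carpet R, ufL C -> ufA C,
      forall C : carpet R, ufA C -> ufB C &
      forall C : carpet R, ufB C -> ufH C] /\
  [/\ exists C : carpet R, ~ (ufA C -> ufL C),
      exists C : carpet R, ~ (ufB C -> ufA C) &
      exists C : carpet R, ~ (ufH C -> ufB C)].
Proof.
split.
  by split; [exact: ufL_ufA|exact: ufA_ufB|exact: ufB_ufH].
split.
- exists (carpet1 R); exact: carpet1_not_ufL.
- exists (carpet2 R); exact: carpet2_not_ufA.
- exists (carpet3 R); exact: carpet3_not_ufB.
Qed.
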